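(* Let $a_1,a_2,\dots\in\mathbb{C}$ be fixed constants. For a parameter $q\in\mathbb{C}$ and $i\in\mathbb{Z}$ put $$z_i(q)=x_ix_{i+1}+q^4a_1x_{i-1}x_{i+2}+q^{12}a_2x_{i-2}x_{i+3}+\dots = x_ix_{i+1}+\sum_{m\ge 1}q^{2m(m+1)}a_m\,x_{i-m}x_{i+m+1}\in A,$$ and let $B(q)$ be the quotient of the algebra $A$ by the ideal generated by $\{z_i(q),\ i\in\mathbb{Z}\}$. (In particular $B(0)$ is the quotient of $A$ by the ideal generated by the monomials $x_ix_{i+1}$, $i\in\mathbb{Z}$.) Then $B(q)$ is a flat deformation of $B(0)$ if and only if the elements $z_i(q)$ satisfy in $A$ $$x_iz_{i+1}(q)-x_{i+2}z_i(q)=\sum_{\beta\in\mathbb{Z}} g_{\beta}(q)\,x_{i-2\beta}\,z_{i+1+\beta}(q),\qquad i\in\mathbb{Z},$$ for some holomorphic functions $g_\beta(q)$, $\beta\in\mathbb{Z}$, of the parameter $q$ (independent of $i$) with $g_\beta(0)=0$.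
   Context: Algebra $A$. Let $P=\mathbb{C}[x_i,\ i\in\mathbb{Z}]$, graded by $\mathbb{Z}^2$ with $\deg(x_i)=(i,1)$, so that $P_{n,l}$ is spanned by monomials $x_{i_1}^{a_1}\cdots x_{i_m}^{a_m}$ with $\sum a_ri_r=n$, $\sum a_r=l$. Let $A_{n,l}$ be the space of infinite formal sums (with complex coefficients) of monomials in $P_{n,l}$ and $A=\bigoplus_{n,l}A_{n,l}$; multiplication is well defined, and $A$ is a commutative associative $\mathbb{Z}^2$-graded algebra. Ideals. For homogeneous elements $g_i\in A$ ($i\in\mathbb{Z}$), the ideal generated by $\{g_i\}$ means the set of all infinite formal sums $\sum_i p_ig_i\in A$ with $p_i\in A$ (each such sum lying in a direct sum of finitely many homogeneous components $A_{n,l}$). Dimensions. Let $C_N\subset A$ be the ideal generated by $x_{N+1},x_{N+2},\dots$. For a graded quotient $Q$ of $A$, $\dim_N Q_{n,l}$ denotes the (finite) dimension of the $(n,l)$ graded component of $Q/C_N$, i.e. of the quotient of $Q$ by the image of $C_N$; statements with $\dim_N$ are always meant for $N\gg0$. Flatness. Let $I_q$ ($q$ a complex parameter) be the ideal generated by a family of homogeneous elements $m_\alpha(q)\in A$ such that $m_\alpha(0)$ are monomials. The deformation $A/I_q$ of $A/I_0$ is called flat if the dimensions of the graded components $(A/I_q)_{n,l}$ and $(A/I_0)_{n,l}$ are equal for all $n,l$, in the sense $\dim_N(A/I_q)_{n,l}=\dim_N(A/I_0)_{n,l}$ for $N\gg0$. *)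

(* Defs.v *)
From HB Require Import structures.
From mathcomp Require Import all_boot all_order all_algebra.
From mathcomp Require Import finmap multiset complex.
From mathcomp Require Import all_classical all_reals all_analysis.

Set Implicit Arguments.
Unset Strict Implicit.
Unset Printing Implicit Defensive.

Import Order.TTheory GRing.Theory Num.Theory.
Import numFieldNormedType.Exports.

Local Open Scope classical_set_scope.
Local Open Scope mset_scope.
Local Open Scope ring_scope.

(* x_(i_1)^a_1 ... x_(i_m)^a_m is the multiset containing i_r with
   multiplicity a_r; the product of monomials is the sum `+` of multisets. *)
Notation monom := {mset int}.

(* If M = x_(i_1)^a_1 ... x_(i_m)^a_m, then [\sum_(i <- M) i] and [size M]
   count multiplicities: they are \sum_r a_r i_r and \sum_r a_r. *)
Definition mdeg (M : monom) : int * int :=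
  (\sum_(i <- (M : seq int)) i, (size (M : seq int))%:Z).

Section Defs.
Variable R : realType.

Local Notation C := (R[i]^o).

(* All formal sums of monomials, given by their coefficients. This contains
   the algebra A as the subset [algA] below. The addition and the scaling are
   the pointwise ones; the multiplication is [smul], NOT the pointwise product
   that the library puts on functions. *)
Definition fseries : lmodType R[i] := monom -> C.

Definition mon (M : monom) : fseries := fun M' => (M' == M)%:R.

Definition X (i : int) : fseries := mon [mset i].

Definition smul (f g : fseries) : fseries :=
  fun M => \sum_(p \in [set p : monom * monom | p.1 `+` p.2 = M])
             (f p.1 * g p.2).

(* The infinite formal sum of the F i, i \in D, is meaningful when each
   monomial occurs in finitely many F i with i \in D; [formal_sum] should only
   be used for such families. *)
Definition locfinite (I : choiceType) (D : set I) (F : I -> fseries) : Prop :=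
  forall M, finite_set [set i | D i /\ F i M != 0].

Definition formal_sum (I : choiceType) (D : set I) (F : I -> fseries) : fseries :=
  fun M => \sum_(i \in D) F i M.

Definition homog (n l : int) : set fseries :=
  [set f | forall M, f M != 0 -> mdeg M = (n, l)].

Definition algA : set fseries :=
  [set f | finite_set [set mdeg M | M in [set M | f M != 0]]].

Definition ideal_gen (I : choiceType) (D : set I) (g : I -> fseries)
    : set fseries :=
  [set s | algA s /\
     exists p : I -> fseries,
       [/\ forall i, D i -> algA (p i),
           locfinite D (fun i => smul (p i) (g i)) &
           s = formal_sum D (fun i => smul (p i) (g i))]].

Definition ideal_sum (I J : set fseries) : set fseries :=
  [set s | exists u v, [/\ I u, J v & s = u + v]].

Definition cutoff (N : int) : set fseries := ideal_gen [set j : int | N < j] X.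

(* For subspaces U and W of V, the space U / (U `&` W) has dimension d: the
   classes of some e_1, ..., e_d \in U form a basis of it. *)
Definition quot_dim (K : fieldType) (V : lmodType K) (U W : set V) (d : nat)
    : Prop :=
  exists e : 'I_d -> V,
    (forall k, U (e k)) /\
    (forall v, U v ->
       exists! c : {ffun 'I_d -> K}, W (v - \sum_(k < d) c k *: e k)).

(* [dimN N I n l d]: dim_N (A / I)_(n, l) = d, for a homogeneous ideal I. *)
Definition dimN (N : int) (I : set fseries) (n l : int) (d : nat) : Prop :=
  quot_dim (homog n l) (ideal_sum I (cutoff N)) d.

Definition flat_deformation (m : R[i] -> int -> fseries) : Prop :=
  forall (q : R[i]) (n l : int),
    exists N0 : int, forall N : int, N0 <= N ->
      exists d : nat, dimN N (ideal_gen setT (m q)) n l d /\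
                      dimN N (ideal_gen setT (m 0)) n l d.

(* The value a 0 is irrelevant. *)
Definition z (a : nat -> R[i]) (q : R[i]) (i : int) : fseries :=
  smul (X i) (X (i + 1)) +
  formal_sum [set m | (1 <= m)%N]
    (fun m : nat => (q ^+ (2 * m * (m + 1))%N * a m) *:
                    smul (X (i - m%:Z)) (X (i + m%:Z + 1))).

(* Complex differentiability everywhere: in [derivable] the increment ranges
   over the scalar field, which is R[i] here. *)
Definition holomorphic (f : R[i] -> R[i]) : Prop :=
  forall q : C, derivable (f : C -> C) q 1.

Lemma smulXl_neq0 (i : int) (f : fseries) (M : monom) :
  smul (X i) f M != 0 -> i \in M /\ f (M `\ i) != 0.
Proof.
move=> H.
have [p [/= pM]] : exists p : monom * monom,
    p.1 `+` p.2 = M /\ X i p.1 * f p.2 != 0.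
  apply: contrapT => nex; move/eqP: H; apply.
  apply: fsbig1 => p /= pM; apply: contrapT => /eqP nz; apply: nex.
  by exists p.
rewrite mulf_eq0 negb_or => /andP[]; rewrite /X /mon.
have [p1|] := eqVneq p.1 [mset i]; last by rewrite eqxx.
by move=> _ nz; rewrite -pM p1 mset1D1 msetDKB.
Qed.

Lemma locfinite_z (a : nat -> R[i]) (q : R[i]) (i : int) :
  locfinite [set m | (1 <= m)%N]
    (fun m : nat => (q ^+ (2 * m * (m + 1))%N * a m) *:
                    smul (X (i - m%:Z)) (X (i + m%:Z + 1))).
Proof.
move=> M.
apply: (sub_finite_set (B := [set m : nat | i - m%:Z \in M])).
  move=> m /= [_ nz].
  have /smulXl_neq0[] // : smul (X (i - m%:Z)) (X (i + m%:Z + 1)) M != 0.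
  apply: contra nz => /eqP e; apply/eqP.
  by rewrite -[LHS]/(_ * smul _ _ M) e mulr0.
apply: (@sub_finite_set _ _
          ((fun j : int => `|i - j|%N) @` [set` (M : seq int)])).
  move=> m /= mM; exists (i - m%:Z) => //.
  by rewrite opprB addrC subrK absz_nat.
exact/finite_image/finite_seq.
Qed.

Lemma locfinite_rel (g : int -> R[i]) (h : int -> fseries) (i : int) :
  locfinite setT (fun b : int => g b *: smul (X (i - 2 * b)) (h b)).
Proof.
move=> M.
apply: (sub_finite_set (B := [set b : int | i - 2 * b \in M])).
  move=> b /= [_ nz].
  have /smulXl_neq0[] // : smul (X (i - 2 * b)) (h b) M != 0.
  apply: contra nz => /eqP e; apply/eqP.
  by rewrite -[LHS]/(_ * smul _ _ M) e mulr0.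
apply: (@sub_finite_set _ _
          ((fun j : int => divz (i - j) 2) @` [set` (M : seq int)])).
  move=> b /= bM; exists (i - 2 * b) => //.
  by rewrite opprB addrC subrK mulrC mulzK.
exact/finite_image/finite_seq.
Qed.

End Defs.

Arguments X {R} i.

(* Main.v *)
Require Import Defs.
From mathcomp Require Import all_boot all_order all_algebra.
From mathcomp Require Import finmap multiset complex zify ring.
From mathcomp Require Import all_classical all_reals all_analysis.

(* Give x_i the weight i^2. The monomials of z_k(q) are x_(k-j) x_(k+j+1), of
   weight k^2 + (k+1)^2 + 2j(j+1), so x_k x_(k+1) is the term of least weight,
   and the substitution x_i -> q^(i^2) x_i carries z_k(1) to a multiple of
   z_k(q) when q <> 0. Modulo the cutoff, and in a fixed degree, everything
   is finite: monomials without two adjacent indices always span A / I_q, and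
   flatness says that they are a basis.
   If relations of the stated form hold, then for small q <> 0 the coefficients
   at b = 0 and b = -1 (which sum to 0) can be moved to the left-hand side, so
   that all terms on the right have larger weight; by the substitution this
   happens for every q. Buchberger's argument, by descending induction on the
   weight, then shows that one generator per leading monomial suffices to span
   the ideal, so no combination of reduced monomials lies in it.
   Conversely, flatness at q = 1 in degree (3, 3) makes the reduction of the
   S-pair x_0 z_1 - x_2 z_0 terminate at 0. This gives a relation modulo each
   cutoff, whose coefficients are unique, hence independent of the cutoff;
   translating indices and substituting gives g_b(q) = c_b q^(6b(b+1)). *)

Set Implicit Arguments.
Unset Strict Implicit.
Unset Printing Implicit Defensive.

Import Order.TTheory GRing.Theory Num.Theory.
Import numFieldNormedType.Exports.

Local Open Scope classical_set_scope.
Local Open Scope mset_scope.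
Local Open Scope ring_scope.

(** * Finite multisets; weights and degrees of monomials *)

Lemma perm_msetD (K : choiceType) (A B : {mset K}) :
  perm_eq (A `+` B : {mset K}) ((A : seq K) ++ B).
Proof.
apply/eq_seq_msetP; rewrite seq_mset_id; apply/msetP => x.
by rewrite mset_seqE count_cat !count_mem_mset msetE2.
Qed.

Lemma msubset_addl (K : choiceType) (A B : {mset K}) : A `<=` (A `+` B).
Proof. by apply/msubsetP => x; rewrite msetE2 leq_addr. Qed.

Lemma seq_has_max (x : int) (s : seq int) : x \in s ->
  exists2 j, j \in s & all (fun i => i <= j) s.
Proof.
elim: s x => // y s IH x _; case: s IH => [|z s] IH.
  by exists y; rewrite ?mem_head //= lexx.
have [j js sj] := IH z (mem_head _ _); have [yj|jy] := leP y j.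
  by exists j; [rewrite in_cons js orbT | apply/andP].
exists y; first exact: mem_head.
apply/allP => i; rewrite in_cons => /predU1P[->//|].
by move/(allP sj)/le_trans; apply; exact: ltW.
Qed.

(** This makes the sums in [smul] finite. The first element of an enumeration of [M] lies in one of
    the two parts, and removing it there leaves a splitting of the rest. *)
Lemma finite_msetD_split (K : choiceType) (M : {mset K}) :
  finite_set [set p : {mset K} * {mset K} | p.1 `+` p.2 = M].
Proof.
rewrite -(seq_mset_id M); elim: (M : seq K) => [|x s IH].
  apply: (@sub_finite_set _ _ [set (mset0, mset0)]) => [[A B] /= AB|//].
  have AB0 y : A y = 0%N /\ B y = 0%N.
    have : (A `+` B) y = 0%N by rewrite AB mset_seqE.
    by rewrite msetE2 => /eqP; rewrite addn_eq0 => /andP[/eqP ? /eqP].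
  by congr pair; apply/msetP => y; rewrite mset0E; case: (AB0 y).
apply: (@sub_finite_set _ _
   ((fun p => (x +` p.1, p.2)) @` [set p : {mset K} * {mset K} | p.1 `+` p.2 = seq_mset s] `|`
    (fun p => (p.1, x +` p.2)) @` [set p : {mset K} * {mset K} | p.1 `+` p.2 = seq_mset s])).
  move=> [A B] /= AB; rewrite mset_cons in AB.
  have : x \in A `+` B by rewrite AB mset1D1.
  rewrite in_msetD => /orP[xA|xB]; [left|right].
    exists (A `\ x, B) => /=; last by rewrite msetB1K.
    by rewrite -[RHS](msetD1K x) -AB -{2}(msetB1K xA) -msetDA msetD1K.
  exists (A, B `\ x) => /=; last by rewrite msetB1K.
  by rewrite -[RHS](msetD1K x) -AB -{2}(msetB1K xB) msetDCA msetD1K.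
by rewrite finite_setU; split; exact: finite_image.
Qed.

Definition weight (M : monom) : nat := (\sum_(i <- (M : seq int)) `|i| ^ 2)%N.

Lemma weightD (M M' : monom) : weight (M `+` M') = (weight M + weight M')%N.
Proof. by rewrite /weight (perm_big _ (perm_msetD _ _)) big_cat. Qed.

Lemma weight1 (i : int) : weight [mset i] = (`|i| ^ 2)%N.
Proof. by rewrite /weight enum_msetn big_seq1. Qed.

Lemma mdegD (M M' : monom) : mdeg (M `+` M') = mdeg M + mdeg M'.
Proof.
rewrite /mdeg (perm_big _ (perm_msetD _ _)) big_cat.
by rewrite (perm_size (perm_msetD _ _)) size_cat PoszD.
Qed.

Lemma mdeg1 (i : int) : mdeg [mset i] = (i, 1).
Proof. by rewrite /mdeg enum_msetn big_seq1. Qed.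

(* The monomials of [z_k]: [x_(k-j) x_(k+j+1)]. *)
Definition zmon (k : int) (j : nat) : monom :=
  [mset k - j%:Z] `+` [mset k + j%:Z + 1].

(** The excess 2j(j+1) is exactly the exponent of q in front of a_j in z_k(q); this is what makes
    the rescaling by weights work. *)
Lemma weight_zmon (k : int) (j : nat) :
  weight (zmon k j) = (weight (zmon k 0) + 2 * j * (j + 1))%N.
Proof.
have sqrz (x : int) : (`|x| ^ 2)%N%:Z = x * x.
  by rewrite expnS expn1 PoszM !abszE -expr2 real_normK ?num_real // expr2.
apply/eqP; rewrite -eqz_nat /zmon !weightD !weight1 !PoszD !sqrz !PoszM PoszD.
by apply/eqP; ring.
Qed.

Lemma zmon_inj (k : int) : injective (zmon k).
Proof.
move=> j j' /(congr1 weight); rewrite weight_zmon [in RHS]weight_zmon.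
have mono m n : (m < n)%N -> (2 * m * (m + 1) < 2 * n * (n + 1))%N.
  by move=> mn; apply: ltn_mul; lia.
by move/addnI => E; case: (ltngtP j j') => // /mono; rewrite E ltnn.
Qed.

Lemma mdeg_zmon (k : int) (j : nat) : mdeg (zmon k j) = (2 * k + 1, 2).
Proof. rewrite /zmon mdegD !mdeg1; congr pair => /=; ring. Qed.

(** * Unitriangular linear systems indexed by a finite list *)

Section Triangular.
Variables (K : fieldType) (T : eqType) (s : seq T) (w : T -> nat).
Variable H : T -> T -> K.
Hypothesis s_uniq : uniq s.
Hypothesis H1 : forall x, x \in s -> H x x = 1.
Hypothesis Hlt : forall x y, x \in s -> y \in s ->
  H x y != 0 -> x = y \/ (w x < w y)%N.

(** Solved in order of increasing [w]: the equation at [y] contains [c y] with coefficient 1 and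
    otherwise only [c x] with [w x < w y]. *)
Lemma triangular_solve (f : T -> K) :
  exists c : T -> K, forall y, y \in s -> f y = \sum_(x <- s) c x * H x y.
Proof.
suff [c Hc] : exists c : T -> K, forall y, y \in s ->
    (w y < (\max_(x <- s) w x).+1)%N -> f y = \sum_(x <- s) c x * H x y.
  by exists c => y ys; apply: Hc => //; rewrite ltnS leq_bigmax_seq.
elim: (\max_(x <- s) w x).+1 => [|n [c Hc]]; first by exists (fun=> 0).
(* The new value is the right one where [w x = n]; where [w x > n] it is provisional and is
   overwritten at later stages. *)
exists (fun x => if (w x < n)%N then c x else
                 f x - \sum_(x' <- s | (w x' < n)%N) c x' * H x' x).
move=> y ys; rewrite ltnS leq_eqVlt => /orP[/eqP wy|wy].
  rewrite (bigD1_seq y) //= H1 // wy ltnn mulr1.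
  rewrite [X in _ = _ + X](_ : _ = \sum_(x' <- s | (w x' < n)%N) c x' * H x' y).
    by rewrite subrK.
  rewrite big_mkcond [RHS]big_mkcond big_seq [RHS]big_seq.
  apply: eq_bigr => x xs; case: eqVneq => [->|nxy /=]; first by rewrite wy ltnn.
  case: ifP => // wx; have [->|/Hlt] := eqVneq (H x y) 0; first by rewrite mulr0.
  by case=> // [xy|]; [rewrite xy eqxx in nxy | rewrite wy wx].
rewrite Hc // big_seq [RHS]big_seq; apply: eq_bigr => x xs.
case: ifP => // wx; have [->|/Hlt] := eqVneq (H x y) 0; first by rewrite !mulr0.
case=> // [xy|wxy]; first by rewrite xy wy in wx.
by rewrite (ltn_trans wxy wy) in wx.
Qed.

Lemma triangular_inj (c : T -> K) :
  (forall y, y \in s -> \sum_(x <- s) c x * H x y = 0) ->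
  forall y, y \in s -> c y = 0.
Proof.
move=> Hc y; have [n] := ubnP (w y); elim: n y => // n IH y wy ys.
have := Hc y ys; rewrite (bigD1_seq y) //= H1 // mulr1 big_seq_cond big1.
  by rewrite addr0.
move=> x /andP[xs nxy]; have [->|/Hlt] := eqVneq (H x y) 0.
  by rewrite mulr0.
case=> // [xy|wxy]; first by rewrite xy eqxx in nxy.
by rewrite IH ?mul0r //; apply: leq_trans wxy _.
Qed.

End Triangular.

(** * Dimension of a quotient and spanning families *)

Section QuotDim.
Variables (K : fieldType) (V : lmodType K) (U W : set V).
Hypothesis W0 : W 0.
Hypothesis WD : forall u v, W u -> W v -> W (u + v).
Hypothesis WZ : forall c u, W u -> W (c *: u).

Let WB u v : W u -> W v -> W (u - v).
Proof. by move=> Wu Wv; rewrite -scaleN1r; apply: WD => //; apply: WZ. Qed.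

Let Wsum n (c : 'I_n -> K) (f : 'I_n -> V) :
  (forall k, W (f k)) -> W (\sum_(k < n) c k *: f k).
Proof. by move=> Wf; apply: big_ind => // k _; apply: WZ. Qed.

Definition spans_mod (r : nat) (f : 'I_r -> V) : Prop :=
  (forall k, U (f k)) /\
  forall v, U v -> exists c : 'I_r -> K, W (v - \sum_(k < r) c k *: f k).

Lemma quot_dim_spans_mod d : quot_dim U W d -> exists e : 'I_d -> V,
  spans_mod e /\
  forall c : 'I_d -> K, W (\sum_(k < d) c k *: e k) -> forall k, c k = 0.
Proof.
move=> [e [Ue He]]; exists e; split.
  by split=> // v /He[c [Wc _]]; exists c.
move=> c Wc k.
(* If the combination with coefficients [c] lies in [W], then the k-th unit vector and its sum with
   [c] are both coordinates of [e k]; by uniqueness they agree. *)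
have Uek := Ue k; have [c0 [_ c0_uniq]] := He _ (Ue k).
have e1 : c0 = [ffun i => (i == k)%:R].
  apply: c0_uniq; rewrite (bigD1 k) //= ffunE eqxx scale1r big1 ?addr0 ?subrr //.
  by move=> i /negPf nik; rewrite ffunE nik scale0r.
have e2 : c0 = [ffun i => (i == k)%:R + c i].
  apply: c0_uniq; under eq_bigr do rewrite ffunE scalerDl.
  rewrite big_split /= (bigD1 k) //= eqxx scale1r [X in _ + X + _]big1; last first.
    by move=> i /negPf nik; rewrite nik scale0r.
  by rewrite addr0 opprD addrA subrr add0r -scaleN1r; exact: WZ.
have := congr1 (fun c : {ffun 'I_d -> K} => c k) e2.
rewrite e1 !ffunE eqxx => /eqP; rewrite -subr_eq0 opprD addrA subrr add0r.
by rewrite oppr_eq0 => /eqP.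
Qed.

(* Transition matrices [P] and [Q] between the two families satisfy [P Q = 1]. *)
Lemma quot_dim_spanning d r (f : 'I_r -> V) :
  quot_dim U W d -> spans_mod f ->
  (d <= r)%N /\
  (d = r -> forall c : 'I_r -> K, W (\sum_(k < r) c k *: f k) ->
     forall k, c k = 0).
Proof.
move=> /quot_dim_spans_mod[e [[Ue He] ie]] [Uf Hf].
have /choice[P HP] k : exists c : 'I_r -> K, W (e k - \sum_(j < r) c j *: f j).
  exact: Hf.
have /choice[Q HQ] k : exists c : 'I_d -> K, W (f k - \sum_(j < d) c j *: e j).
  exact: He.
pose PM := \matrix_(i, j) P i j; pose QM := \matrix_(i, j) Q i j.
have expand n m (c : 'I_n -> K) (p : 'I_n -> 'I_m -> K) (h : 'I_m -> V) :
    \sum_(k < n) c k *: (\sum_(j < m) p k j *: h j) =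
    \sum_(j < m) (\sum_(k < n) c k * p k j) *: h j.
  under eq_bigr do rewrite scaler_sumr.
  rewrite exchange_big; apply: eq_bigr => j _; rewrite scaler_suml.
  by apply: eq_bigr => k _; rewrite scalerA.
have PQ : PM *m QM = 1%:M.
  apply/matrixP => i j; apply/eqP; rewrite -subr_eq0; apply/eqP.
  pose c j' := (PM *m QM) i j' - (1%:M : 'M[K]_d) i j'.
  rewrite -/(c j); apply: (ie c).
  have -> : \sum_(k < d) c k *: e k =
      \sum_(k < d) (PM *m QM) i k *: e k - e i.
    under eq_bigr do rewrite /c scalerBl.
    rewrite sumrB; congr (_ - _); rewrite (bigD1 i) //= mxE eqxx scale1r.
    rewrite big1 ?addr0 // => k nki; rewrite mxE eq_sym (negPf nki).
    by rewrite scale0r.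
  have -> : \sum_(k < d) (PM *m QM) i k *: e k =
      \sum_(k < r) P i k *: \sum_(j < d) Q k j *: e j.
    rewrite expand; apply: eq_bigr => k _; rewrite mxE; congr (_ *: _).
    by apply: eq_bigr => l _; rewrite !mxE.
  rewrite -opprB -scaleN1r; apply: WZ.
  rewrite -[X in W X](subrKA (\sum_(k < r) P i k *: f k)); apply: WD => //.
  rewrite -sumrB; under eq_bigr do rewrite -scalerBr.
  exact: Wsum.
split; first exact: (mulmx1_min PQ).
move=> dr; subst r => c Wc k.
have QP : QM *m PM = 1%:M by apply: mulmx1C.
(* Rewriting the [f k] in the basis [e] gives C Q = 0. The matrices are now square, so Q P = 1 as
   well, and C = C Q P = 0. *)
pose C := \row_j c j.
have CQ : C *m QM = 0.
  apply/matrixP => i j; rewrite [RHS]mxE.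
  apply: (ie (fun j => (C *m QM) i j)).
  have -> : \sum_(k < d) (C *m QM) i k *: e k =
      \sum_(k < d) c k *: \sum_(j < d) Q k j *: e j.
    rewrite expand; apply: eq_bigr => l _; rewrite mxE; congr (_ *: _).
    by apply: eq_bigr => l' _; rewrite !mxE.
  rewrite -[X in W X](subKr (\sum_(k < d) c k *: f k)); apply: WB => //.
  by rewrite -sumrB; under eq_bigr do rewrite -scalerBr; exact: Wsum.
have : C = 0 by rewrite -[C]mulmx1 -QP mulmxA CQ mul0mx.
by move/matrixP/(_ 0 k); rewrite !mxE.
Qed.

End QuotDim.

(** * Formal series and ideals *)

Section Algebra.
Variable R : realType.
Local Notation C := (R[i]).
Local Notation fseries := (fseries R).
Implicit Types (f g h : fseries) (M m : monom).

Lemma fsD f g M : (f + g) M = f M + g M. Proof. by []. Qed.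
Lemma fsZ (c : C) f M : (c *: f) M = c * f M. Proof. by []. Qed.
Lemma fs0 M : (0 : fseries) M = 0. Proof. by []. Qed.
Lemma fsN f M : (- f) M = - f M. Proof. by []. Qed.
Lemma fs_sum (I : Type) (r : seq I) (P : pred I) (F : I -> fseries) M :
  (\sum_(i <- r | P i) F i) M = \sum_(i <- r | P i) F i M.
Proof. by elim/big_rec2: _ => [|i x y _ <-]. Qed.

Lemma smulC f g : smul f g = smul g f.
Proof.
apply/funext => M; rewrite /smul.
rewrite (reindex_fsbig (fun p : monom * monom => (p.2, p.1))
   [set p | p.1 `+` p.2 = M]).
  by apply: eq_fsbigr => p _; rewrite mulrC.
split=> [[A B]|[A B] [A' B'] _ _ [-> ->] //|[A B]] /=; first by rewrite msetDC.
by move=> AB; exists (B, A); rewrite //= msetDC.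
Qed.

Lemma smul_mon m f M :
  smul (mon R m) f M = if m `<=` M then f (M `\` m) else 0.
Proof.
rewrite /smul; case: ifP => mM; last first.
  apply: fsbig1 => -[A B] /= AB; rewrite /mon; case: eqP => [Am|_].
    by rewrite -AB Am msubset_addl in mM.
  by rewrite mul0r.
rewrite -(@fsbig_widen _ _ _ _ [set (m, M `\` m)]).
- by rewrite fsbig_set1 /= /mon eqxx mul1r.
- by move=> p ->; rewrite /= msetBDKC.
- move=> [A B] [/= AB nAB]; rewrite /mon; case: eqP => [Am|_].
    by exfalso; apply: nAB; rewrite -AB Am msetDKB.
  by rewrite mul0r.
Qed.

Lemma smul_mon_mon m m' : smul (mon R m) (mon R m') = mon R (m `+` m').
Proof.
apply/funext => M; rewrite smul_mon /mon; case: ifP => mM.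
  congr (_ %:R); congr nat_of_bool; apply/eqP/eqP => [<-|->].
    by rewrite msetBDKC.
  by rewrite msetDKB.
by case: eqP => // Mm; rewrite Mm msubset_addl in mM.
Qed.

Lemma smulDl f f' g : smul (f + f') g = smul f g + smul f' g.
Proof.
apply/funext => M; rewrite /smul -[RHS]fsbig_split; last exact: finite_msetD_split.
by apply: eq_fsbigr => p _; rewrite fsD mulrDl.
Qed.

Lemma smulZl (c : C) f g : smul (c *: f) g = c *: smul f g.
Proof.
apply/funext => M; rewrite fsZ /smul mulr_fsumr.
by apply: eq_fsbigr => p _; rewrite mulrA.
Qed.

Lemma algAD f g : algA f -> algA g -> algA (f + g).
Proof.
move=> Af Ag; apply: (@sub_finite_set _ _
  ([set mdeg M | M in [set M | f M != 0]] `|` [set mdeg M | M in [set M | g M != 0]])).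
  move=> _ [M /= fgM <-]; have [fM|fM] := eqVneq (f M) 0; last by left; exists M.
  right; exists M => //=; apply: contra fgM => /eqP gM.
  by rewrite fsD fM gM addr0.
by rewrite finite_setU.
Qed.

Lemma algAZ (c : C) f : algA f -> algA (c *: f).
Proof.
apply: sub_finite_set => _ [M /= cM <-]; exists M => //=.
apply: contra cM => /eqP fM; by rewrite fsZ fM mulr0.
Qed.

Lemma algA0 : algA (0 : fseries).
Proof.
apply: (@sub_finite_set _ _ set0) => // _ [M /= + _].
by rewrite fs0 eqxx.
Qed.

Lemma homog_algA n l f : homog n l f -> algA f.
Proof.
move=> Hf; apply: (@sub_finite_set _ _ [set (n, l)]) => // _ [M /= + <-].
exact: Hf.
Qed.

Lemma homog_mon m : homog (mdeg m).1 (mdeg m).2 (mon R m).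
Proof.
move=> M; rewrite /mon; case: (M =P m) => [->|_]; last by rewrite eqxx.
by rewrite -surjective_pairing.
Qed.

Lemma homogD n l f g : homog n l f -> homog n l g -> homog n l (f + g).
Proof.
move=> Hf Hg M fg; have [fM|] := eqVneq (f M) 0; last exact: Hf.
by apply: Hg; apply: contra fg => /eqP gM; rewrite fsD fM gM addr0.
Qed.

Lemma homogZ n l (c : C) f : homog n l f -> homog n l (c *: f).
Proof.
move=> Hf M cf; apply: Hf; apply: contra cf => /eqP fM.
by rewrite fsZ fM mulr0.
Qed.

Lemma homog0 n l : homog n l (0 : fseries).
Proof. by move=> M; rewrite fs0 eqxx. Qed.

Section Ideals.
Variables (I : choiceType) (D : set I) (G : I -> fseries).

Lemma ideal_gen0 : ideal_gen D G 0.
Proof.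
split; first exact: algA0; exists (fun=> 0).
have sm0 g : smul (0 : fseries) g = 0.
  by apply/funext => M; apply: fsbig1 => p _; exact: mul0r.
split; first by move=> *; exact: algA0.
  move=> M; apply: (@sub_finite_set _ _ set0) => // i /= [_].
  by rewrite sm0 fs0 eqxx.
by apply/funext => M; rewrite /formal_sum fsbig1 // => i _; rewrite sm0.
Qed.

Lemma ideal_genD f g : ideal_gen D G f -> ideal_gen D G g -> ideal_gen D G (f + g).
Proof.
move=> [Af [p [Ap Lp fE]]] [Ag [p' [Ap' Lp' gE]]].
split; first exact: algAD.
exists (fun i => p i + p' i); split; first by move=> i Di; apply: algAD; auto.
  move=> M; apply: (@sub_finite_set _ _ ([set i | D i /\ smul (p i) (G i) M != 0] `|`
      [set i | D i /\ smul (p' i) (G i) M != 0])); last by rewrite finite_setU.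
  move=> i /= [Di]; rewrite smulDl => pp.
  have [p0|] := eqVneq (smul (p i) (G i) M) 0; [right|left] => //; split=> //.
  by apply: contra pp => /eqP p'0; rewrite fsD p0 p'0 addr0.
apply/funext => M; rewrite fE gE fsD.
rewrite /formal_sum.
(* A finite set outside which both families vanish at [M], so that the two sums can be added
   termwise. *)
pose F := ([set i | D i /\ smul (p i) (G i) M != 0] `|`
           [set i | D i /\ smul (p' i) (G i) M != 0])%classic.
have Ffin : finite_set F by rewrite finite_setU.
have FD : (F `<=` D)%classic by move=> i [[]|[]].
rewrite -!(@fsbig_widen _ _ _ _ F D) //.
- rewrite -[LHS]fsbig_split //; apply: eq_fsbigr => i _.
  by rewrite smulDl.
- move=> i [Di /not_orP[/not_andP[//|/negP/negPn/eqP p0]]].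
  move=> /not_andP[//|/negP/negPn/eqP p'0] /=.
  by rewrite smulDl fsD p0 p'0 addr0.
- by move=> i [Di /not_orP[_ /not_andP[//|/negP/negPn/eqP p0]]].
- by move=> i [Di /not_orP[/not_andP[//|/negP/negPn/eqP p0] _]].
Qed.

Lemma ideal_genZ (c : C) f : ideal_gen D G f -> ideal_gen D G (c *: f).
Proof.
move=> [Af [p [Ap Lp fE]]]; split; first exact: algAZ.
exists (fun i => c *: p i); split; first by move=> i Di; apply: algAZ; auto.
  move=> M; apply: sub_finite_set (Lp M) => i /= [Di]; rewrite smulZl => cp.
  by split=> //; apply: contra cp => /eqP p0; rewrite fsZ p0 mulr0.
apply/funext => M; rewrite fE fsZ /formal_sum mulr_fsumr.
by apply: eq_fsbigr => i _; rewrite smulZl.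
Qed.

Lemma ideal_gen_smul i p : D i -> algA p -> algA (smul p (G i)) ->
  ideal_gen D G (smul p (G i)).
Proof.
move=> Di Ap ApG; split=> //; exists (fun j => if j == i then p else 0).
have sm0 g : smul (0 : fseries) g = 0.
  by apply/funext => M; apply: fsbig1 => ? _; exact: mul0r.
split; first by move=> j _; case: ifP => // _; exact: algA0.
  move=> M; apply: (@sub_finite_set _ _ [set i]) => // j /= [_].
  by case: (j =P i) => // _; rewrite sm0 fs0 eqxx.
apply/funext => M; rewrite /formal_sum -(@fsbig_widen _ _ _ _ [set i]).
- by rewrite fsbig_set1 eqxx.
- by move=> j ->.
- by move=> j [_ /= /eqP/negPf ->]; rewrite sm0.
Qed.

End Ideals.

Section IdealSum.
Variables (I J : set fseries).

Lemma ideal_sum0 : I 0 -> J 0 -> ideal_sum I J 0.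
Proof. by exists 0, 0; split=> //; rewrite addr0. Qed.

Lemma ideal_sumD : (forall f g, I f -> I g -> I (f + g)) ->
  (forall f g, J f -> J g -> J (f + g)) ->
  forall f g, ideal_sum I J f -> ideal_sum I J g -> ideal_sum I J (f + g).
Proof.
move=> ID JD f g [u [v [Iu Jv ->]]] [u' [v' [Iu' Jv' ->]]].
by exists (u + u'), (v + v'); split; [exact: ID|exact: JD|rewrite addrACA].
Qed.

Lemma ideal_sumZ : (forall c f, I f -> I (c *: f)) ->
  (forall c f, J f -> J (c *: f)) ->
  forall c f, ideal_sum I J f -> ideal_sum I J (c *: f).
Proof.
move=> IZ JZ c f [u [v [Iu Jv ->]]].
by exists (c *: u), (c *: v); split; [exact: IZ|exact: JZ|rewrite scalerDr].
Qed.

End IdealSum.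

Definition bounded (N : int) M := all (fun i => i <= N) M.

Lemma boundedP N M : reflect (forall i, i \in M -> i <= N) (bounded N M).
Proof. exact: allP. Qed.

Lemma boundedD N M M' : bounded N (M `+` M') = bounded N M && bounded N M'.
Proof.
apply/boundedP/andP => [H|[/boundedP H /boundedP H'] i].
  by split; apply/boundedP => i iM; apply: H; rewrite in_msetD iM ?orbT.
by rewrite in_msetD => /orP[/H|/H'].
Qed.

Lemma bounded1 N i : bounded N [mset i] = (i <= N).
Proof. by apply/boundedP/idP => [->//|iN j /mset1P ->]; rewrite ?mset11. Qed.

Lemma cutoff_bounded N f M : cutoff N f -> bounded N M -> f M = 0.
Proof.
move=> [_ [p [_ _ ->]]] bM; apply: fsbig1 => j /= Nj; apply/eqP.
apply/negPn/negP; rewrite smulC => /smulXl_neq0[jM _].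
by move/boundedP: bM => /(_ j jM); rewrite leNgt Nj.
Qed.

(* The monomial [M] is assigned to the generator [x_j] with [j] the largest
   index in [M]. *)
Lemma bounded_cutoff N f :
  algA f -> (forall M, bounded N M -> f M = 0) -> cutoff N f.
Proof.
move=> Af f0; split=> //.
pose p j : fseries := fun M => if bounded j M then f (j +` M) else 0.
have pX j M : smul (p j) (X j) M = if (j \in M) && bounded j M then f M else 0.
  rewrite smulC smul_mon msub1set; case: ifP => //= jM; rewrite /p.
  rewrite msetB1K //; have -> // : bounded j M = bounded j (M `\ j).
  by rewrite -{1}(msetB1K jM) boundedD bounded1 lexx.
exists p; split.
- move=> j _; apply: (@sub_finite_set _ _
    ((fun d => d - (j, 1)) @` [set mdeg M | M in [set M | f M != 0]])).
    move=> _ [M /= + <-]; rewrite /p; case: ifP => [_ fM|_]; last by rewrite eqxx.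
    exists (mdeg (j +` M)); first by exists (j +` M).
    by rewrite mdegD mdeg1 addrC addKr.
  exact: finite_image.
- move=> M; apply: (@sub_finite_set _ _ [set` (M : seq int)]).
    by move=> j /= [_]; rewrite pX; case: (j \in M) => //; rewrite eqxx.
  exact: finite_seq.
- apply/funext => M; rewrite /formal_sum.
  under eq_fsbigr do rewrite pX.
  have [bM|] := boolP (bounded N M).
    by rewrite f0 // fsbig1 // => j _; case: ifP.
  rewrite -has_predC => /hasP[x xM /=]; rewrite -ltNge => Nx.
  have [j jM bj] := seq_has_max xM.
  have Nj : N < j by apply: lt_le_trans Nx _; move/allP: bj; exact.
  rewrite -(@fsbig_widen _ _ _ _ [set j]).
  + by rewrite fsbig_set1 jM /bounded bj.
  + by move=> i ->.
  move=> i [_ /= /eqP ij]; case: ifP => // /andP[iM bi]; case/eqP: ij.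
  apply/eqP; rewrite eq_le; move/allP: bj => /(_ i iM) ->.
  by move/allP: bi; exact.
Qed.

End Algebra.

(** * Homogeneous components modulo the cutoff *)

(** If l indices are at most N and sum to n, each of them is at least n - (l-1)N, so only finitely
    many values are possible. *)
Lemma finite_bounded_mdeg (N n l : int) :
  finite_set [set M : monom | bounded N M && (mdeg M == (n, l))].
Proof.
pose L := absz l; pose lo := n - (l - 1) * N.
pose K := (absz (N - lo)).+1.
apply: (@sub_finite_set _ _
  ((fun t : L.-tuple 'I_K => seq_mset [seq lo + (nat_of_ord i)%:Z | i <- t]) @` setT)).
  move=> M /= /andP[/boundedP bM /eqP[sumM szM]].
  have loM x : x \in M -> lo <= x.
    move=> xM; have sumN (s : seq int) : all (fun i => i <= N) s ->
        \sum_(i <- s) i <= (size s)%:Z * N.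
      elim: s => [|y s IH] /=; first by rewrite big_nil mul0r.
      by move=> /andP[yN /IH]; rewrite big_cons intS mulrDl mul1r; exact: lerD.
    have := perm_to_rem xM => pM.
    have : all (fun i => i <= N) (rem x M).
      by apply/allP => i /mem_rem; exact: bM.
    move/sumN; rewrite size_rem // => le_sum.
    move: sumM; rewrite (perm_big _ pM) big_cons /= => sumM.
    have size_gt0 : (0 < size M)%N by rewrite (perm_size pM).
    have szE : (size M).-1%:Z = l - 1 by rewrite -szM -[in RHS](prednK size_gt0) intS addrC addKr.
    by move: le_sum; rewrite szE /lo -sumM => le_sum; rewrite -addrA gerDl subr_le0.
  have szt : size [seq inord (absz (x - lo)) : 'I_K | x <- (M : seq int)] == L.
    by rewrite size_map /L -szM.
  exists (Tuple szt) => //=; rewrite -map_comp -[RHS]seq_mset_id; congr seq_mset.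
  rewrite -[RHS]map_id; apply/eq_in_map => x xM /=.
  have lox := loM x xM; have xN := bM x xM.
  rewrite inordK; first by rewrite gez0_abs ?subr_ge0 // subrKC.
  rewrite /K ltnS -lez_nat !gez0_abs ?subr_ge0 ?lerD2r //.
  exact: le_trans lox xN.
exact/finite_image/finite_finset.
Qed.

Definition comp_monoms (N n l : int) : seq monom :=
  fset_set [set M : monom | bounded N M && (mdeg M == (n, l))].

Lemma mem_comp_monoms N n l M :
  (M \in comp_monoms N n l) = bounded N M && (mdeg M == (n, l)).
Proof.
by rewrite /comp_monoms in_fset_set ?mem_setE //; exact: finite_bounded_mdeg.
Qed.

Lemma comp_monoms_uniq N n l : uniq (comp_monoms N n l).
Proof. exact: fset_uniq. Qed.

(** A pair (m, k) stands for the generator m z_k; this is its term of least weight. *)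
Definition lead (t : monom * int) : monom := t.1 `+` zmon t.2 0.

Lemma mem_lead (t : monom * int) : t.2 \in lead t.
Proof. by rewrite /lead /zmon !in_msetD in_mset1 subr0 eqxx orbT. Qed.

Lemma leadK (t : monom * int) : lead t `\` zmon t.2 0 = t.1.
Proof. by rewrite /lead msetDC msetDKB. Qed.

(** Every [k] in [M] is tried. If [k + 1] is not in [M], the multiset difference removes only [k],
    so the lead has l + 1 factors and the filter discards the pair. *)
Definition comp_gens (N n l : int) : seq (monom * int) :=
  undup [seq t <- [seq (M `\` zmon k 0, k) | M <- comp_monoms N n l, k <- (M : seq int)]
        | lead t \in comp_monoms N n l].

Lemma mem_comp_gens N n l t :
  (t \in comp_gens N n l) = (lead t \in comp_monoms N n l).
Proof.
rewrite mem_undup mem_filter andb_idr // => tS.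
apply/allpairsPdep; exists (lead t), t.2; split=> //; first exact: mem_lead.
by rewrite leadK -surjective_pairing.
Qed.

Lemma comp_gens_uniq N n l : uniq (comp_gens N n l).
Proof. exact: undup_uniq. Qed.

(** The largest index of x_(k-j) x_(k+j+1) is at least k + 1, so if any term of m z_k survives the
    cutoff, its leading term does. *)
Lemma lead_comp_monoms N n l (t : monom * int) j :
  t.1 `+` zmon t.2 j \in comp_monoms N n l -> lead t \in comp_monoms N n l.
Proof.
rewrite !mem_comp_monoms /lead !(mdegD t.1) !mdeg_zmon => /andP[+ ->]; rewrite andbT.
rewrite /zmon !boundedD !bounded1 => /andP[-> /andP[_ kN]] /=.
by apply/andP; split; lia.
Qed.

(** * The generators m z_k and the ideal in a fixed degree *)

Section Relations.
Variables (R : realType) (a : nat -> R[i]).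
Local Notation C := (R[i]).
Local Notation fseries := (fseries R).
Implicit Types (f g h : fseries) (M m : monom) (q : C).

Definition zcoef q (j : nat) : C :=
  if j is 0 then 1 else q ^+ (2 * j * (j + 1)) * a j.

Lemma smul_zmon k j : smul (X (k - j%:Z)) (X (k + j%:Z + 1)) = mon R (zmon k j).
Proof. exact: smul_mon_mon. Qed.

Lemma zE q k M : z a q k M = (M == zmon k 0)%:R +
  \sum_(j \in [set j | (1 <= j)%N]) zcoef q j * (M == zmon k j)%:R.
Proof.
rewrite /z fsD; congr (_ + _).
  by have := smul_zmon k 0; rewrite (subr0 k) => ->.
apply: eq_fsbigr => -[|j]; rewrite inE //= => _.
by rewrite fsZ smul_zmon.
Qed.

Lemma z_supp q k M : z a q k M != 0 -> exists j, M = zmon k j.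
Proof.
apply: contraPP => nM; have Mj j : (M == zmon k j) = false.
  by apply/eqP => Mj; apply: nM; exists j.
rewrite zE Mj add0r fsbig1 ?eqxx // => j _.
by rewrite Mj mulr0.
Qed.

Lemma z_zmon q k j : z a q k (zmon k j) = zcoef q j.
Proof.
rewrite zE; case: j => [|j].
  rewrite eqxx fsbig1 ?addr0 // => -[//|j] _.
  by rewrite (inj_eq (@zmon_inj k)) mulr0.
rewrite (inj_eq (@zmon_inj k)) add0r -(@fsbig_widen _ _ _ _ [set j.+1]).
- by rewrite fsbig_set1 eqxx mulr1.
- by move=> i ->.
- by move=> i [_ /= /eqP/negPf ij]; rewrite (inj_eq (@zmon_inj k)) eq_sym ij mulr0.
Qed.

Definition gen q (t : monom * int) : fseries := smul (mon R t.1) (z a q t.2).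

Lemma gen_zmon q m k j : gen q (m, k) (m `+` zmon k j) = zcoef q j.
Proof. by rewrite /gen smul_mon msubset_addl msetDKB z_zmon. Qed.

Lemma gen_lead q t : gen q t (lead t) = 1.
Proof. by case: t => m k; rewrite /lead gen_zmon. Qed.

Lemma gen_supp q t M : gen q t M != 0 -> exists j, M = t.1 `+` zmon t.2 j.
Proof.
rewrite /gen smul_mon; case: ifP => [tM /z_supp[j Mj]|]; last by rewrite eqxx.
by exists j; rewrite -Mj msetBDKC.
Qed.

Lemma gen_homog q t : homog (mdeg (lead t)).1 (mdeg (lead t)).2 (gen q t).
Proof.
move=> M /gen_supp[j ->]; rewrite /lead !(mdegD t.1) !mdeg_zmon.
by rewrite -surjective_pairing.
Qed.

Lemma gen_weight q t M : gen q t M != 0 ->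
  M = lead t \/ (weight (lead t) < weight M)%N.
Proof.
move=> /gen_supp[[|j] ->]; first by left.
by right; rewrite /lead !(weightD t.1) ltn_add2l [ltnRHS]weight_zmon -addn1 leq_add2l; lia.
Qed.

Variables (N n l : int).
Local Notation S := (comp_monoms N n l).
Local Notation D := (comp_gens N n l).

(* Membership in [ideal_gen setT (z a q)] modulo [cutoff N], in degree [(n, l)]. *)
Definition comp_ideal q f : Prop := exists c : monom * int -> C,
  forall M, M \in S -> f M = \sum_(t <- D) c t * gen q t M.

Lemma comp_ideal0 q : comp_ideal q 0.
Proof.
by exists (fun=> 0) => M _; rewrite big1 // => t _; rewrite mul0r.
Qed.

Lemma comp_idealD q f g : comp_ideal q f -> comp_ideal q g -> comp_ideal q (f + g).
Proof.
move=> [c Hc] [c' Hc']; exists (fun t => c t + c' t) => M MS.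
rewrite fsD Hc // Hc' // -big_split; apply: eq_bigr => t _; exact/esym/mulrDl.
Qed.

Lemma comp_idealZ q (b : C) f : comp_ideal q f -> comp_ideal q (b *: f).
Proof.
move=> [c Hc]; exists (fun t => b * c t) => M MS.
by rewrite fsZ Hc // mulr_sumr; apply: eq_bigr => t _; exact: mulrA.
Qed.

Lemma eq_comp_ideal q f g : (forall M, M \in S -> f M = g M) ->
  comp_ideal q f -> comp_ideal q g.
Proof. by move=> fg [c Hc]; exists c => M MS; rewrite -fg // Hc. Qed.

Lemma gen_out q t M : t \notin D -> M \in S -> gen q t M = 0.
Proof.
rewrite mem_comp_gens => tD MS; apply/eqP/negPn/negP => /gen_supp[j Mj].
by case/negP: tD; apply: (@lead_comp_monoms _ _ _ _ j); rewrite -Mj.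
Qed.

Lemma gen_comp_ideal q t : comp_ideal q (gen q t).
Proof.
have [tD|tD] := boolP (t \in D).
  exists (fun t' => (t' == t)%:R) => M MS.
  rewrite (bigD1_seq t) ?comp_gens_uniq //= eqxx mul1r big1 ?addr0 //.
  by move=> t' /negPf ->; rewrite mul0r.
apply: eq_comp_ideal (comp_ideal0 q) => M MS.
by rewrite gen_out.
Qed.

(** At a monomial of [S] the cutoff part vanishes, and the coefficient of p_k at m can contribute
    only if (m, k) is in [D]; the infinite combination thus becomes a finite one. *)
Lemma ideal_comp_ideal q f :
  ideal_sum (ideal_gen setT (z a q)) (cutoff N) f -> comp_ideal q f.
Proof.
move=> [u [v [[_ [p [_ _ ->]]] vN ->]]].
exists (fun t => p t.2 t.1) => M MS.
have bM : bounded N M by move: MS; rewrite mem_comp_monoms => /andP[].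
rewrite fsD (cutoff_bounded vN bM) addr0.
have termE k : smul (p k) (z a q k) M =
    \sum_(t <- D) if t.2 == k then p k t.1 * gen q t M else 0.
  (* The splittings of [M] that can contribute: the second factor must be a monomial of z_k, which
     forces the first to come from a member of [D]. *)
  pose r := [seq (t.1, M `\` t.1) | t <- D & (t.2 == k) && (t.1 `<=` M)].
  have r_uniq : uniq r.
    rewrite map_inj_in_uniq ?filter_uniq ?comp_gens_uniq //.
    move=> [m1 k1] [m2 k2]; rewrite !mem_filter /=.
    by move=> /andP[/andP[/eqP -> _] _] /andP[/andP[/eqP -> _] _] [->].
  rewrite [LHS](@fsbigE _ _ _ _ _ r) //; last 2 first.
  - move=> _ /mapP[t + ->] /=; rewrite mem_filter => /andP[/andP[_ tM] _].
    exact: msetBDKC.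
  - move=> [m m'] /= mm' /negP nr; apply/eqP/negPn/negP.
    rewrite mulf_eq0 negb_or => /andP[_ /z_supp[j m'j]]; apply: nr.
    apply/mapP; exists (m, k) => /=; last by rewrite -mm' msetDKB.
    rewrite mem_filter /= eqxx -mm' msubset_addl mem_comp_gens.
    by apply: (@lead_comp_monoms _ _ _ _ j); rewrite -m'j mm'.
  rewrite /r big_map big_filter_cond big_mkcond; apply: eq_bigr => -[m k'] _ /=.
  case: (k' =P k) => //= ->; rewrite /gen smul_mon /=.
  case: (boolP (m `<=` M)) => mM /=; last by rewrite mulr0.
  by rewrite mem_set //= msetBDKC.
rewrite /formal_sum (@fsbigE _ _ _ _ _ (undup [seq t.2 | t <- D])) ?undup_uniq //; last first.
  move=> k _ kD; rewrite termE big_seq big1 // => t tD; case: eqP => // tk.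
  by case/negP: kD; rewrite mem_undup; apply/mapP; exists t.
under eq_bigl do rewrite in_setT.
under eq_bigr do rewrite termE.
rewrite exchange_big /= big_seq [RHS]big_seq; apply: eq_bigr => t tD.
rewrite (bigD1_seq t.2) ?undup_uniq ?mem_undup ?map_f //= eqxx big1 ?addr0 //.
by move=> k /negPf; rewrite eq_sym => ->.
Qed.

(** The finite combination [u] agrees with [f] on [S], and [f - u] is homogeneous, so each of its
    monomials has an index above [N] and it lies in the cutoff. *)
Lemma comp_ideal_ideal q f : homog n l f -> comp_ideal q f ->
  ideal_sum (ideal_gen setT (z a q)) (cutoff N) f.
Proof.
move=> Hf [c Hc]; pose u : fseries := \sum_(t <- D) c t *: gen q t.
have Hu : homog n l u /\ ideal_gen setT (z a q) u.
  rewrite /u big_seq; elim/big_ind: _ => [|u1 u2 [H1 I1] [H2 I2]|t].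
  - by split; [exact: homog0|exact: ideal_gen0].
  - by split; [exact: homogD|exact: ideal_genD].
  rewrite mem_comp_gens mem_comp_monoms => /andP[_ /eqP dt].
  have Ht : homog n l (gen q t) by have := @gen_homog q t; rewrite dt.
  split; first exact: homogZ.
  apply: ideal_genZ; apply: ideal_gen_smul => //; last exact: homog_algA Ht.
  exact: homog_algA (@homog_mon R t.1).
exists u, (f - u); split; first by case: Hu.
  have Hfu : homog n l (f - u).
    by apply: homogD => //; rewrite -scaleN1r; apply: homogZ; case: Hu.
  apply: bounded_cutoff; first exact: homog_algA Hfu.
  move=> M bM; have [MS|MS] := boolP (M \in S).
    by rewrite fsD fsN Hc // /u fs_sum subrr.
  apply/eqP/negPn/negP => /Hfu dM; case/negP: MS.
  by rewrite mem_comp_monoms bM dM eqxx.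
by rewrite addrC subrK.
Qed.

End Relations.

(** * Reduced monomials *)

Lemma zmon0 k : zmon k 0 = [mset k] `+` [mset k + 1].
Proof. by rewrite /zmon (subr0 k). Qed.

Definition reduced (M : monom) := ~~ has (fun i => i + 1 \in M) M.

Lemma lead_nonreduced t : ~~ reduced (lead t).
Proof.
rewrite negbK; apply/hasP; exists t.2; first exact: mem_lead.
by rewrite /lead zmon0 !in_msetD !in_mset1 eqxx !orbT.
Qed.

(** One generator for each nonreduced monomial, having it as its lead. For reduced [M] the default
    [k = 0] is taken and carries no meaning. *)
Definition sel (M : monom) : monom * int :=
  let k := nth 0 M (find (fun i => i + 1 \in M) M) in (M `\` zmon k 0, k).

Lemma zmon0_sub k M : k \in M -> k + 1 \in M -> zmon k 0 `<=` M.
Proof.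
move=> kM k1M; apply/msubsetP => x; rewrite zmon0 msetE2 !msetnE.
case: (x =P k) => [->|_]; case: (_ =P _) => [e|_] //.
- by exfalso; lia.
- by rewrite mset_gt0.
- by rewrite e mset_gt0.
Qed.

Lemma lead_sel M : ~~ reduced M -> lead (sel M) = M.
Proof.
rewrite negbK => rM; rewrite /lead /sel /= msetBDK // zmon0_sub //.
  by rewrite mem_nth // -has_find.
exact: (nth_find 0 rM).
Qed.

Section Basis.
Variables (R : realType) (a : nat -> R[i]) (N n l : int).
Local Notation C := (R[i]).
Local Notation fseries := (fseries R).
Implicit Types (f g h : fseries) (M m : monom) (q : C).
Local Notation S := (comp_monoms N n l).
Local Notation D := (comp_gens N n l).
Local Notation W q := (ideal_sum (ideal_gen setT (z a q)) (cutoff N)).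

Definition red_monoms := [seq M <- S | reduced M].
Definition nonred_monoms := [seq M <- S | ~~ reduced M].
Local Notation Sr := red_monoms.
Local Notation Sn := nonred_monoms.

Lemma mem_nonred_monoms M : (M \in Sn) = ~~ reduced M && (M \in S).
Proof. exact: mem_filter. Qed.

Lemma gen_selP q M M' : M \in Sn -> M' \in Sn ->
  gen a q (sel M) M' != 0 -> M = M' \/ (weight M < weight M')%N.
Proof.
rewrite !mem_nonred_monoms => /andP[rM _] _ /gen_weight.
by rewrite lead_sel // => -[|]; [left|right].
Qed.

Lemma gen_sel_diag q M : M \in Sn -> gen a q (sel M) M = 1.
Proof.
rewrite mem_nonred_monoms => /andP[/lead_sel selM _].
by have := gen_lead a q (sel M); rewrite selM.
Qed.

(** On the nonreduced monomials, ordered by weight, the selected generators form a unitriangular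
    matrix, so they realise any prescribed coefficients there. *)
Lemma gen_sel_solve q f : exists c : monom -> C, forall M, M \in Sn ->
  f M = \sum_(M' <- Sn) c M' * gen a q (sel M') M.
Proof.
apply: (@triangular_solve _ _ _ weight (fun M' M => gen a q (sel M') M)).
- by rewrite filter_uniq ?comp_monoms_uniq.
- exact: gen_sel_diag.
- exact: gen_selP.
Qed.

Lemma gen_sel_inj q (c : monom -> C) : (forall M, M \in Sn ->
  \sum_(M' <- Sn) c M' * gen a q (sel M') M = 0) -> forall M, M \in Sn -> c M = 0.
Proof.
apply: (@triangular_inj _ _ _ weight (fun M' M => gen a q (sel M') M)).
- by rewrite filter_uniq ?comp_monoms_uniq.
- exact: gen_sel_diag.
- exact: gen_selP.
Qed.

Definition red_basis (k : 'I_(size Sr)) : fseries := mon R (nth mset0 Sr k).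

Lemma red_basis_nth (c : 'I_(size Sr) -> C) (j : 'I_(size Sr)) :
  (\sum_k c k *: red_basis k) (nth mset0 Sr j) = c j.
Proof.
rewrite fs_sum (bigD1 j) //= fsZ /red_basis /mon eqxx mulr1 big1 ?addr0 //.
move=> k /negPf kj; rewrite fsZ nth_uniq ?filter_uniq ?comp_monoms_uniq //.
by rewrite eq_sym (inj_eq val_inj) kj mulr0.
Qed.

Lemma red_basis_out (c : 'I_(size Sr) -> C) M :
  M \notin Sr -> (\sum_k c k *: red_basis k) M = 0.
Proof.
move=> MS; rewrite fs_sum big1 // => k _; rewrite fsZ /red_basis /mon.
case: (M =P _) => [Mk|_]; last by rewrite mulr0.
by case/negP: MS; rewrite Mk mem_nth.
Qed.

Lemma red_basis_homog k : homog n l (red_basis k).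
Proof.
have := mem_nth mset0 (ltn_ord k); rewrite mem_filter mem_comp_monoms.
move=> /and3P[_ _ /eqP dk]; rewrite /red_basis.
by have := @homog_mon R (nth mset0 Sr k); rewrite dk.
Qed.

Lemma red_basis_sum_homog (c : 'I_(size Sr) -> C) :
  homog n l (\sum_k c k *: red_basis k).
Proof.
elim/big_ind: _ => [||k _]; [exact: homog0|exact: homogD|].
exact/homogZ/red_basis_homog.
Qed.

Lemma ideal_cutoff0 q : W q 0.
Proof. by apply: ideal_sum0; exact: ideal_gen0. Qed.

Lemma ideal_cutoffD q f g : W q f -> W q g -> W q (f + g).
Proof. by apply: ideal_sumD => *; exact: ideal_genD. Qed.

Lemma ideal_cutoffZ q (c : C) f : W q f -> W q (c *: f).
Proof. by apply: ideal_sumZ => *; exact: ideal_genZ. Qed.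

(** Subtracting the combination of selected generators that has the same nonreduced coefficients
    leaves only reduced monomials. *)
Lemma red_basis_spans q : spans_mod (homog n l) (W q) red_basis.
Proof.
split; first exact: red_basis_homog.
move=> v Hv; have [c Hc] := gen_sel_solve q v.
pose u : fseries := \sum_(M' <- Sn) c M' *: gen a q (sel M').
exists (fun k => (v - u) (nth mset0 Sr k)).
apply: (@comp_ideal_ideal _ _ N n l).
  apply: homogD => //; rewrite -scaleN1r; apply: homogZ.
  exact: red_basis_sum_homog.
apply: (@eq_comp_ideal _ _ _ _ _ _ u); last first.
  rewrite /u; elim/big_ind: _ => [||M' _]; [exact: comp_ideal0|exact: comp_idealD|].
  exact/comp_idealZ/gen_comp_ideal.
move=> M MS; rewrite fsD fsN; have [rM|rM] := boolP (reduced M); last first.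
  rewrite red_basis_out ?mem_filter ?negb_and ?rM // subr0 Hc.
    by rewrite /u fs_sum.
  by rewrite mem_nonred_monoms rM.
have MSr : (index M Sr < size Sr)%N by rewrite index_mem mem_filter rM.
have <- : nth mset0 Sr (Ordinal MSr) = M by rewrite /= nth_index // -index_mem.
by rewrite red_basis_nth fsD fsN opprB addrC subrK.
Qed.

Definition red_indep q := forall c : 'I_(size Sr) -> C,
  W q (\sum_k c k *: red_basis k) -> forall k, c k = 0.

Lemma red_indep_dimN q : red_indep q ->
  dimN N (ideal_gen setT (z a q)) n l (size Sr).
Proof.
move=> iq; exists red_basis; split; first exact: red_basis_homog.
move=> v Hv; have [c Hc] := (red_basis_spans q).2 v Hv.
exists [ffun k => c k]; split.
  by under eq_bigr do rewrite ffunE.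
move=> c' Hc'; apply/ffunP => k; rewrite ffunE; apply/eqP; rewrite -subr_eq0.
apply/eqP; apply: (iq (fun k => c k - c' k)).
under eq_bigr do rewrite scalerBl; rewrite sumrB.
rewrite -[X in W q X]opprK opprB.
have -> : \sum_k c' k *: red_basis k - \sum_k c k *: red_basis k =
  (v - \sum_k c k *: red_basis k) - (v - \sum_k c' k *: red_basis k).
  by rewrite opprB [RHS]addrC subrKA.
have WN f : W q f -> W q (- f) by rewrite -scaleN1r; exact: ideal_cutoffZ.
by apply: (WN); apply: ideal_cutoffD => //; exact: WN.
Qed.

End Basis.

(** * Reduction by means of the relations *)

Lemma finite_zmon_sub k (M : monom) : finite_set [set j | zmon k j `<=` M].
Proof.
apply: (@sub_finite_set _ _ ((fun i => absz (k - i)) @` [set` (M : seq int)])).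
  move=> j /= jM; exists (k - j%:Z).
    by apply: (msubset_subset jM); rewrite /zmon mset1D1.
  by rewrite opprB addrC subrK absz_nat.
exact/finite_image/finite_seq.
Qed.

Definition rel_lead (i b : int) : monom := lead ([mset i - 2 * b], i + 1 + b).

(** b(b+1) is never negative at an integer, so [absz] changes only the type. *)
Definition pronic (b : int) : nat := absz (b * (b + 1)).

Lemma pronicE (b : int) : (pronic b)%:Z = b * (b + 1).
Proof.
rewrite /pronic gez0_abs //; have [b0|b0] := leP 0 b.
  by apply: mulr_ge0 => //; lia.
by apply: mulr_le0; lia.
Qed.

Lemma weight_rel_lead i b :
  weight (rel_lead i b) = (weight (rel_lead i 0) + 6 * pronic b)%N.
Proof.
have sqrz (x : int) : (`|x| ^ 2)%N%:Z = x * x.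
  by rewrite expnS expn1 PoszM !abszE -expr2 real_normK ?num_real // expr2.
have : (6 * pronic b)%N%:Z = 6 * (b * (b + 1)) by rewrite PoszM pronicE.
move: (6 * pronic b)%N => p pE.
apply/eqP; rewrite -eqz_nat /rel_lead /lead !zmon0 !weightD !weight1 !PoszD !sqrz.
by rewrite pE; apply/eqP => /=; ring.
Qed.

Lemma pronic_gt0 b : b != 0 -> b != -1 -> (0 < pronic b)%N.
Proof. by rewrite /pronic absz_gt0 mulf_eq0 addr_eq0 negb_or => -> ->. Qed.

Section Relation.
Variables (R : realType) (a : nat -> R[i]).
Local Notation C := (R[i]).
Local Notation fseries := (fseries R).
Implicit Types (f g h : fseries) (M m : monom) (q : C).

Lemma gen_shift q m m' k M : gen a q (m `+` m', k) M =
  if m `<=` M then gen a q (m', k) (M `\` m) else 0.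
Proof.
rewrite /gen !smul_mon /= msetBDA.
have -> : (m `+` m' `<=` M) = (m `<=` M) && (m' `<=` (M `\` m)).
  apply/idP/andP => [mM|[mM m'M]].
    split; first exact: msubset_trans (msubset_addl _ _) mM.
    by rewrite -[m'](msetDKB m); exact: msetSB.
  by rewrite -[M](msetBDKC mM); exact: msetDS.
by case: (m `<=` M).
Qed.

(* [x_(i-2b) z_(i+1+b)] *)
Definition rel_term q (i b : int) : fseries := gen a q ([mset i - 2 * b], i + 1 + b).

(** The terms at b = 0 and b = -1 are x_i z_(i+1) and x_(i+2) z_i, so their difference is the
    S-pair. *)
Definition relation q (c : int -> C) : Prop := forall i M,
  rel_term q i 0 M - rel_term q i (-1) M =
  \sum_(b \in [set: int]) c b * rel_term q i b M.

(** With these two terms absent, all leads on the right of a relation have larger weight than the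
    S-pair's common lead. *)
Definition normalized (c : int -> C) : Prop := c 0 = 0 /\ c (-1) = 0.

Lemma locfinite_gen_shift q m i (c : int -> C) :
  locfinite setT (fun b : int => c b *: gen a q (m `+` [mset i - 2 * b], i + 1 + b)).
Proof.
move=> M; apply: (@sub_finite_set _ _
   ((fun j : int => divz (i - j) 2) @` [set` (M : seq int)])).
  move=> b /= [_]; rewrite fsZ => nz.
  have /gen_supp[j /= Mj] : gen a q (m `+` [mset i - 2 * b], i + 1 + b) M != 0.
    by apply: contra nz => /eqP ->; rewrite mulr0.
  exists (i - 2 * b); first by rewrite Mj !in_msetD in_mset1 eqxx orbT.
  by rewrite opprB addrC subrK mulrC mulzK.
exact/finite_image/finite_seq.
Qed.

(** The product m z_k z_k', with the factor z_k expanded into monomials. *)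
Definition koszul q m k k' : fseries :=
  formal_sum [set: nat] (fun j => zcoef a q j *: gen a q (m `+` zmon k j, k')).

Lemma koszulE q m k k' M : koszul q m k k' M =
  if m `<=` M then smul (z a q k) (z a q k') (M `\` m) else 0.
Proof.
rewrite /koszul /formal_sum; under eq_fsbigr do rewrite fsZ gen_shift.
case: ifP => _; last by rewrite fsbig1 // => j _; rewrite mulr0.
move: (M `\` m) => {}M; rewrite /smul.
rewrite -(@fsbig_widen _ _ _ _ [set j | zmon k j `<=` M]) //; last first.
  move=> j [_ /= /negP/negPf jM]; rewrite /gen smul_mon /= jM.
  by rewrite mulr0.
rewrite -(@fsbig_widen _ _ _ _
   [set p : monom * monom | p.1 `+` p.2 = M /\ exists j, p.1 = zmon k j]); last 2 first.
- by move=> p [].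
- move=> p [/= pM /not_andP[//|np]]; apply/eqP/negPn/negP.
  by rewrite mulf_eq0 negb_or => /andP[/z_supp].
rewrite [RHS](reindex_fsbig (fun j => (zmon k j, M `\` zmon k j))
    [set j | zmon k j `<=` M]).
  apply: eq_fsbigr => j; rewrite inE /= => jM.
  by rewrite z_zmon /gen smul_mon /= jM.
split=> [j /= jM|j j' _ _ [] /zmon_inj //|[A B] /= [AB [j Aj]]].
  by split; [exact: msetBDKC|exists j].
by exists j; rewrite /= -AB Aj ?msubset_addl ?msetDKB.
Qed.

(** Expanding either factor gives the same product; this is the Koszul syzygy between z_k and
    z_k'. *)
Lemma koszulC q m k k' : koszul q m k k' = koszul q m k' k.
Proof.
apply/funext => M.
rewrite (koszulE q m k k') (koszulE q m k' k).
exact: (congr1 (fun f : fseries => if m `<=` M then f (M `\` m) else 0) (smulC _ _)).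
Qed.

Lemma koszul0 q m k k' : koszul q m k k' = gen a q (m `+` zmon k 0, k') +
  formal_sum [set j | (1 <= j)%N] (fun j => zcoef a q j *: gen a q (m `+` zmon k j, k')).
Proof.
apply/funext => M; rewrite /koszul fsD /formal_sum.
pose F := ([set j | (zmon k j `<=` M)%mset] `|` [set 0%N])%classic.
have finF : finite_set F by rewrite finite_setU; split=> //; exact: finite_zmon_sub.
have F0 j : ~ F j -> (zcoef a q j *: gen a q (m `+` zmon k j, k')) M = 0.
  move=> /not_orP[jM _]; rewrite fsZ msetDC gen_shift.
  by case: ifP => [kM|_]; [case: jM|rewrite mulr0].
rewrite -(@fsbig_widen _ _ _ _ F) //; last by move=> j [_ /F0].
rewrite (fsbigD1 0%N) //=; last by right.
rewrite fsZ mul1r; congr (_ + _); apply: fsbig_widen.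
  by move=> j [_ /= /eqP]; rewrite -lt0n.
by move=> j [/= j1 nj]; apply: F0 => Fj; apply: nj; split=> // j0; rewrite j0 in j1.
Qed.

Variables (N n l : int).
Local Notation S := (comp_monoms N n l).
Local Notation Sn := (nonred_monoms N n l).

Definition sel_span q f : Prop := exists c : monom -> C,
  forall M, M \in S -> f M = \sum_(M' <- Sn) c M' * gen a q (sel M') M.

Lemma eq_sel_span q f g : (forall M, M \in S -> f M = g M) ->
  sel_span q f -> sel_span q g.
Proof. by move=> fg [c Hc]; exists c => M MS; rewrite -fg // Hc. Qed.

Lemma sel_span0 q : sel_span q 0.
Proof. by exists (fun=> 0) => M _; rewrite big1 // => t _; rewrite mul0r. Qed.

Lemma sel_spanD q f g : sel_span q f -> sel_span q g -> sel_span q (f + g).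
Proof.
move=> [c Hc] [c' Hc']; exists (fun t => c t + c' t) => M MS.
rewrite fsD Hc // Hc' // -big_split; apply: eq_bigr => t _; exact/esym/mulrDl.
Qed.

Lemma sel_spanZ q (b : C) f : sel_span q f -> sel_span q (b *: f).
Proof.
move=> [c Hc]; exists (fun t => b * c t) => M MS.
by rewrite fsZ Hc // mulr_sumr; apply: eq_bigr => t _; exact: mulrA.
Qed.

Lemma sel_spanN q f : sel_span q f -> sel_span q (- f).
Proof. by rewrite -scaleN1r; exact: sel_spanZ. Qed.

(** On the finite list [S] only finitely many members of a locally finite family are nonzero. *)
Lemma sel_span_formal_sum q (I : choiceType) (E : set I) (F : I -> fseries) :
  locfinite E F -> (forall i, E i -> sel_span q (F i)) ->
  sel_span q (formal_sum E F).
Proof.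
move=> Ef HF; pose B := \bigcup_(M in [set` S]) [set i | E i /\ F i M != 0].
have finB : finite_set B by apply: bigcup_finite; [exact: finite_seq|].
apply: (@eq_sel_span _ (\sum_(i <- fset_set B) F i)).
  move=> M MS; rewrite fs_sum /formal_sum -fsbig_finite //.
  apply: fsbig_widen => [i [M' _ []]//|i [Ei nB] /=].
  by apply/eqP/negPn/negP => iM; apply: nB; exists M.
rewrite big_seq; elim/big_ind: _ => [||i]; [exact: sel_span0|exact: sel_spanD|].
by rewrite in_fset_set // inE => -[M _ [Ei _]]; exact: HF.
Qed.

Lemma gen_sel_span q M : M \in Sn -> sel_span q (gen a q (sel M)).
Proof.
move=> MSn; exists (fun M' => (M' == M)%:R) => M' _.
rewrite (bigD1_seq M) ?filter_uniq ?comp_monoms_uniq //= eqxx mul1r.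
by rewrite big1 ?addr0 // => M'' /negPf ->; rewrite mul0r.
Qed.

(* S-pairs: overlapping leading monomials differ by the relation, disjoint ones
   by a Koszul syzygy; both only involve generators of larger weight. *)
Lemma sel_span_swap q c t t' : relation q c -> normalized c ->
  lead t = lead t' -> (t.2 <= t'.2) ->
  (forall s, (weight (lead t) < weight (lead s))%N -> sel_span q (gen a q s)) ->
  sel_span q (gen a q t' - gen a q t).
Proof.
case: t t' => [m1 k] [m2 k'] rc [c0 cN1] ltt' /= kk' IH.
move: kk'; rewrite le_eqVlt => /predU1P[kk'|].
  have -> : m1 = m2 by have := leadK (m2, k'); rewrite -ltt' -kk' leadK.
  rewrite kk'; apply: eq_sel_span (sel_span0 q) => M _.
  by rewrite fsD fsN subrr.
(* Adjacent case k' = k + 1: here m1 = m x_(k+2) and m2 = m x_k, so the difference is m times the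
   left-hand side of the relation. *)
rewrite -lezD1 le_eqVlt => /predU1P[kk'|kk'].
  have k2 : k + 2 \in m1.
    have : k + 2 \in lead (m1, k).
      by rewrite ltt' /lead zmon0 -kk' !in_msetD !in_mset1 -addrA eqxx !orbT.
    rewrite /lead zmon0 !in_msetD !in_mset1 => /orP[//|/orP[]/eqP /= k2]; exfalso; lia.
  pose m := m1 `\ (k + 2).
  have m1E : m1 = m `+` [mset k + 2] by rewrite msetDC msetB1K.
  have m2E : m2 = m `+` [mset k].
    have := leadK (m2, k'); rewrite -ltt' /lead /= !zmon0 m1E -kk' => <-.
    apply/msetP => x; rewrite -addrA (_ : 1 + 1 = 2) // !msetE2.
    by move: (m1 x) ([mset k + 2] x) ([mset k] x) ([mset k + 1] x) => *; lia.
  have genE M : (gen a q (m2, k') - gen a q (m1, k)) M =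
      formal_sum setT (fun b : int => c b *: gen a q (m `+` [mset k - 2 * b], k + 1 + b)) M.
    rewrite fsD fsN m1E m2E -kk' !gen_shift /formal_sum.
    under eq_fsbigr do rewrite fsZ gen_shift.
    case: (m `<=` M); last by rewrite subrr fsbig1 // => b _; exact: mulr0.
    apply: etrans (rc k (M `\` m)); rewrite /rel_term.
    have -> : k - 2 * 0 = k by lia.
    have -> : k - 2 * -1 = k + 2 by lia.
    have -> : k + 1 + 0 = k + 1 by lia.
    by have -> : k + 1 + -1 = k by lia.
  apply: (@eq_sel_span _ (formal_sum setT (fun b : int =>
      c b *: gen a q (m `+` [mset k - 2 * b], k + 1 + b)))).
    by move=> M _; rewrite genE.
  apply: sel_span_formal_sum; first exact: locfinite_gen_shift.
  move=> b _; have [->|b0] := eqVneq b 0; first by rewrite c0 scale0r; exact: sel_span0.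
  have [->|b1] := eqVneq b (-1); first by rewrite cN1 scale0r; exact: sel_span0.
  have wb : weight ([mset k - 2 * b] `+` zmon (k + 1 + b) 0) =
      (weight (rel_lead k 0) + 6 * pronic b)%N := weight_rel_lead k b.
  have wk : weight ([mset k + 2] `+` zmon k 0) = (weight (rel_lead k 0) + 0)%N.
    have := weight_rel_lead k (-1); rewrite {1}/rel_lead /lead /=.
    have -> : k - 2 * -1 = k + 2 by lia.
    by have -> : k + 1 + -1 = k by lia.
  apply/sel_spanZ/IH; rewrite /lead m1E /= -!msetDA !(weightD m) ltn_add2l.
  by rewrite wb wk ltn_add2l; have := pronic_gt0 b0 b1; lia.
(* Disjoint case k' > k + 1: the lead is m times both leading monomials. Equating the two expansions
   of m z_k z_k' and isolating their first terms expresses the difference by terms of larger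
   weight. *)
have k'm : zmon k' 0 `<=` m1.
  have inm1 x : k + 1 < x -> x \in zmon k' 0 -> x \in m1.
    move=> kx xk'; have : x \in lead (m1, k) by rewrite ltt' /lead in_msetD xk' orbT.
    rewrite /lead zmon0 !in_msetD !in_mset1 => /orP[//|/orP[]/eqP /= xk]; exfalso; lia.
  apply: zmon0_sub; apply: inm1; rewrite ?zmon0 ?in_msetD ?in_mset1 ?eqxx ?orbT //.
  by lia.
pose m := m1 `\` zmon k' 0.
have m1E : m1 = m `+` zmon k' 0 by rewrite msetBDK.
have m2E : m2 = m `+` zmon k 0.
  have := leadK (m2, k'); rewrite -ltt' /lead /= m1E => <-.
  by rewrite -msetDA msetDC -msetDA msetDKB msetDC.
have lfF k1 k2 : locfinite [set j | (1 <= j)%N]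
    (fun j => zcoef a q j *: gen a q (m `+` zmon k1 j, k2)).
  move=> M; apply: sub_finite_set (finite_zmon_sub k1 M) => j /= [_].
  rewrite fsZ msetDC gen_shift; case: ifP => //.
  by rewrite mulr0 eqxx.
have hF k1 k2 : weight (lead (m1, k)) = weight (lead (m `+` zmon k1 0, k2)) ->
    sel_span q (formal_sum [set j | (1 <= j)%N]
      (fun j => zcoef a q j *: gen a q (m `+` zmon k1 j, k2))).
  move=> wE; apply: sel_span_formal_sum => // j /= j1.
  apply/sel_spanZ/IH; rewrite wE /lead /= !(weightD (m `+` _)) !(weightD m) (weight_zmon k1 j).
  by rewrite ltn_add2r ltn_add2l -addn1 leq_add2l; lia.
have -> : gen a q (m2, k') - gen a q (m1, k) =
    formal_sum [set j | (1 <= j)%N]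
      (fun j => zcoef a q j *: gen a q (m `+` zmon k' j, k)) -
    formal_sum [set j | (1 <= j)%N]
      (fun j => zcoef a q j *: gen a q (m `+` zmon k j, k')).
  have := koszulC q m k k'; rewrite !koszul0 -m1E -m2E => E.
  by apply/eqP; rewrite subr_eq addrAC eq_sym subr_eq E addrC.
apply: sel_spanD; last apply: sel_spanN; apply: hF.
  by rewrite -m1E.
by rewrite -m2E ltt'.
Qed.

Lemma gen_in_sel_span q c : relation q c -> normalized c ->
  forall t, sel_span q (gen a q t).
Proof.
(* Weights on [S] are at most [B], so induction on [B.+1 - weight] runs downwards in weight; a
   generator whose lead is outside [S] vanishes on [S]. *)
move=> rc nc t; pose B := \max_(M <- S) weight M.
have [k] := ubnP (B.+1 - weight (lead t)); elim: k t => // k IH t.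
rewrite ltnS => tk; have [tS|tS] := boolP (lead t \in S); last first.
  apply: eq_sel_span (sel_span0 q) => M MS.
  by rewrite (@gen_out _ a N n l) ?mem_comp_gens.
have tB : (weight (lead t) <= B)%N by rewrite /B leq_bigmax_seq.
have {}IH s : (weight (lead t) < weight (lead s))%N -> sel_span q (gen a q s).
  by move=> ts; apply: IH; apply: leq_trans tk; rewrite ltn_sub2l // ltnS.
have tSn : lead t \in Sn by rewrite mem_nonred_monoms lead_nonreduced.
have ls := lead_sel (lead_nonreduced t).
have H := gen_sel_span q tSn.
case: (leP t.2 (sel (lead t)).2) => [le_k|/ltW le_k].
  have Hs := sel_span_swap rc nc (esym ls) le_k IH.
  have := sel_spanD H (sel_spanN Hs); rewrite opprB addrC.
  by rewrite subrK.
have IH' s : (weight (lead (sel (lead t))) < weight (lead s))%N -> sel_span q (gen a q s).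
  by rewrite ls; exact: IH.
have := sel_spanD (sel_span_swap rc nc ls le_k IH') H.
by rewrite subrK.
Qed.

(** Such a combination is also one of selected generators; its nonreduced coefficients are zero, so
    unitriangularity makes all its coefficients [g] zero. *)
Lemma relation_red_indep q c : relation q c -> normalized c ->
  red_indep a N n l q.
Proof.
move=> rc nc b Wb k; have [c' Hc'] := ideal_comp_ideal n l Wb.
set f := \sum_k b k *: red_basis R k in Hc'.
have [g Hg] : sel_span q f.
  apply: (@eq_sel_span _ (\sum_(t <- comp_gens N n l) c' t *: gen a q t)).
    by move=> M MS; rewrite Hc' // fs_sum.
  elim/big_ind: _ => [||t _]; [exact: sel_span0|exact: sel_spanD|].
  exact/sel_spanZ/(gen_in_sel_span rc nc).
have g0 M : M \in Sn -> g M = 0.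
  apply: (@gen_sel_inj _ a _ _ _ q) => {}M; rewrite mem_nonred_monoms => /andP[rM MS].
  by rewrite -Hg // /f red_basis_out // mem_filter (negPf rM).
rewrite -(red_basis_nth b k) -/f Hg.
  by rewrite big_seq big1 // => M /g0 ->; rewrite mul0r.
by have := mem_nth mset0 (ltn_ord k); rewrite mem_filter => /andP[].
Qed.

End Relation.

(** * Dependence of the relations on q *)

Lemma rel_leadN1 i : rel_lead i (-1) = rel_lead i 0.
Proof.
rewrite /rel_lead /lead /= !zmon0.
have -> : i - 2 * -1 = i + 2 by lia.
have -> : i + 1 + -1 = i by lia.
have -> : i - 2 * 0 = i by lia.
have -> : i + 1 + 0 = i + 1 by lia.
have -> : i + 1 + 1 = i + 2 by lia.
by rewrite msetDC msetDA.
Qed.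

Lemma pronic_eq0 b : pronic b = 0%N -> b = 0 \/ b = -1.
Proof.
move=> pb; have [->|b0] := eqVneq b 0; first by left.
have [->|b1] := eqVneq b (-1); first by right.
by have := pronic_gt0 b0 b1; rewrite pb.
Qed.

(** Equal weights leave b' = b or b' = -1 - b. In the second case the index -2b would equal 2b+2, -b
    or 1-b, which only the excluded values of b allow. *)
Lemma rel_lead_inj b b' : b != 0 -> b != -1 ->
  rel_lead 0 b = rel_lead 0 b' -> b = b'.
Proof.
move=> b0 b1 lbb'; have := congr1 weight lbb'.
rewrite (weight_rel_lead 0 b) (weight_rel_lead 0 b') => /addnI/eqP.
rewrite eqn_mul2l /= => /eqP/(congr1 Posz); rewrite !pronicE => /eqP.
have -> : (b * (b + 1) == b' * (b' + 1)) = ((b - b') * (b + b' + 1) == 0).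
  by rewrite -subr_eq0; congr (_ == _); ring.
rewrite mulf_eq0 subr_eq0 => /orP[/eqP //|/eqP bb'].
have : 0 - 2 * b \in rel_lead 0 b'.
  by rewrite -lbb' /rel_lead /lead in_msetD in_mset1 eqxx.
have {b' lbb' bb'}-> : b' = - b - 1 by lia.
rewrite /rel_lead /lead /= zmon0 !in_msetD !in_mset1.
by move: b0 b1 => /eqP b0 /eqP b1 /or3P[] /eqP; lia.
Qed.

Lemma mdeg_rel_lead i b : mdeg (rel_lead i b) = (3 * i + 3, 3).
Proof.
rewrite /rel_lead /lead /= mdegD mdeg_zmon mdeg1.
by congr pair => /=; ring.
Qed.


Section RelTerms.
Variables (R : realType) (a : nat -> R[i]).
Local Notation C := (R[i]).
Local Notation fseries := (fseries R).
Implicit Types (f g h : fseries) (M m : monom) (q : C).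

Lemma rel_term0 q i : rel_term a q i 0 = smul (X i) (z a q (i + 1)).
Proof.
rewrite /rel_term /gen /X /=.
have -> : i - 2 * 0 = i by lia.
by have -> : i + 1 + 0 = i + 1 by lia.
Qed.

Lemma rel_termN1 q i : rel_term a q i (-1) = smul (X (i + 2)) (z a q i).
Proof.
rewrite /rel_term /gen /X /=.
have -> : i - 2 * -1 = i + 2 by lia.
by have -> : i + 1 + -1 = i by lia.
Qed.

Local Opaque gen.

Lemma rel_term_lead q i b : rel_term a q i b (rel_lead i b) = 1.
Proof. exact: gen_lead. Qed.

Lemma rel_term_homog q i b : homog (3 * i + 3) 3 (rel_term a q i b).
Proof.
have := @gen_homog R a q ([mset i - 2 * b], i + 1 + b).
by rewrite -/(rel_lead i b) mdeg_rel_lead.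
Qed.

Lemma rel_term_supp q i b M : rel_term a q i b M != 0 ->
  M = rel_lead i b \/ (weight (rel_lead i b) < weight M)%N.
Proof. exact: gen_weight. Qed.

Lemma rel_term_lead_neq0 q i b b' : rel_term a q i b (rel_lead i b') != 0 ->
  rel_lead i b' = rel_lead i b \/ (pronic b < pronic b')%N.
Proof.
move=> /rel_term_supp[|]; first by left.
by rewrite (weight_rel_lead i b) (weight_rel_lead i b') ltn_add2l ltn_pmul2l //; right.
Qed.

Lemma rel_term_bounded q i b N M : rel_term a q i b M != 0 -> bounded N M ->
  bounded N (rel_lead i b).
Proof.
move=> /gen_supp[j /= ->]; rewrite /rel_lead /lead /= /zmon !boundedD !bounded1.
move=> /and3P[-> _ kN] /=.
by apply/andP; split; lia.
Qed.

(** A contributing b has i - 2b among the indices of [M]. The list [r] does not depend on [c], so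
    two relations can be compared termwise, and [b0] is included so that its term can be singled
    out. *)
Lemma rel_sumE q i M b0 : exists r : seq int,
  [/\ uniq r, {in r, forall b, b != 0 /\ b != -1},
      b0 != 0 -> b0 != -1 -> b0 \in r &
  forall c : int -> C, \sum_(b \in [set: int]) c b * rel_term a q i b M =
    c 0 * rel_term a q i 0 M + (c (-1) * rel_term a q i (-1) M +
    \sum_(b <- r) c b * rel_term a q i b M)].
Proof.
pose r := [seq b <- undup (b0 :: [seq divz (i - j) 2 | j <- (M : seq int)])
          | (b != 0) && (b != -1)].
have r_uniq : uniq r by rewrite filter_uniq ?undup_uniq.
exists r; split=> //.
- by move=> b; rewrite mem_filter => /andP[/andP[]].
- by move=> b00 b01; rewrite mem_filter b00 b01 mem_undup mem_head.
move=> c; rewrite (@fsbigE _ _ _ _ _ [:: 0, -1 & r]) //.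
- by under eq_bigl do rewrite in_setT; rewrite !big_cons.
- by rewrite /= in_cons !mem_filter.
move=> b _ br; apply/eqP/negPn/negP; rewrite mulf_eq0 negb_or => /andP[_ nz].
case/negP: br; rewrite !in_cons mem_filter mem_undup.
have [//|_] := eqVneq b 0; have [//|_] := eqVneq b (-1).
rewrite /= in_cons; apply/orP; right.
apply/mapP; exists (i - 2 * b); last by rewrite opprB addrC subrK mulrC mulzK.
have /gen_supp[j /= ->] := nz.
by rewrite !in_msetD in_mset1 eqxx.
Qed.

(** The substitution x_i -> q^(i^2) x_i read on coefficients, multiplied out to avoid division. *)
Lemma gen_scale q t M :
  gen a q t M * q ^+ weight (lead t) = gen a 1 t M * q ^+ weight M.
Proof.
have [[j ->]|nj] := pselect (exists j, M = t.1 `+` zmon t.2 j); last first.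
  have g0 q' : gen a q' t M = 0 by apply/eqP/negPn/negP => /gen_supp.
  by rewrite !g0 !mul0r.
case: t => m k /=; rewrite !gen_zmon /lead /= !(weightD m) (weight_zmon k j).
case: j => [|j]; first by rewrite addn0.
rewrite /zcoef expr1n mul1r addnA [in RHS]exprD -mulrA mulrCA; congr (_ * _).
exact: mulrC.
Qed.

Lemma rel_term_scale q i b M :
  rel_term a q i b M * (q ^+ weight (rel_lead i 0) * q ^+ (6 * pronic b)) =
  rel_term a 1 i b M * q ^+ weight M.
Proof. by rewrite -exprD -weight_rel_lead; exact: gen_scale. Qed.

Lemma relation_scale q (c : int -> C) : q != 0 ->
  relation a q (fun b => c b * q ^+ (6 * pronic b)) <-> relation a 1 c.
Proof.
move=> q0.
have q_neq0 k : q ^+ k != 0 by rewrite expf_neq0.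
have lhsE i M : (rel_term a q i 0 M - rel_term a q i (-1) M) * q ^+ weight (rel_lead i 0) =
    (rel_term a 1 i 0 M - rel_term a 1 i (-1) M) * q ^+ weight M.
  have := rel_term_scale q i 0 M; have := rel_term_scale q i (-1) M.
  rewrite (_ : pronic 0 = 0%N) // (_ : pronic (-1) = 0%N) // expr0 mulr1 => e1 e0.
  exact: etrans (mulrBl _ _ _) (etrans (congr2 (fun x y => x - y) e0 e1) (esym (mulrBl _ _ _))).
have rhsE i M : (\sum_(b \in [set: int]) c b * q ^+ (6 * pronic b) * rel_term a q i b M)
      * q ^+ weight (rel_lead i 0) =
    (\sum_(b \in [set: int]) c b * rel_term a 1 i b M) * q ^+ weight M.
  rewrite !mulr_fsuml; apply: eq_fsbigr => b _.
  have e := rel_term_scale q i b M.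
  have mulE (x y u v : C) : x * y * u * v = x * (u * (v * y)) by ring.
  by rewrite -[RHS]mulrA -e; exact: mulE.
split=> rc i M.
  apply: (mulIf (q_neq0 (weight M))).
  exact: etrans (esym (lhsE i M)) (etrans (congr1 (fun x => x * _) (rc i M)) (rhsE i M)).
apply: (mulIf (q_neq0 (weight (rel_lead i 0)))).
exact: etrans (lhsE i M) (etrans (congr1 (fun x => x * _) (rc i M)) (esym (rhsE i M))).
Qed.

Lemma gen_q0 t M : gen a 0 t M = (M == lead t)%:R.
Proof.
case: (M =P lead t) => [->|Mt]; first exact: gen_lead.
apply/eqP/negPn/negP => nz; have /gen_supp[j Mj] := nz.
move: nz; rewrite Mj; case: t Mt Mj => m k /= Mt Mj; rewrite gen_zmon.
case: j Mj => [//|j] _; rewrite /zcoef expr0n /=.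
by rewrite mul0r eqxx.
Qed.

Lemma relation_q0 (c : int -> C) : (forall b, c b = 0) -> relation a 0 c.
Proof.
move=> c0 i M; rewrite fsbig1 => [|b _]; last by rewrite c0 mul0r.
rewrite /rel_term !gen_q0 -/(rel_lead i 0) -/(rel_lead i (-1)) rel_leadN1.
exact: subrr.
Qed.

Lemma relation1_relation q (c : int -> C) : relation a 1 c -> normalized c ->
  relation a q (fun b => c b * q ^+ (6 * pronic b)).
Proof.
(* At q = 0 there is no rescaling, but every coefficient is zero: at b = 0 and b = -1 by
   normalization, elsewhere because the exponent is positive. *)
move=> rc [c0 cN1]; have [->|q0] := eqVneq q 0; last exact/relation_scale.
apply: relation_q0 => b; rewrite expr0n; case: eqP => [|_]; last exact: mulr0.
by move/eqP; rewrite muln_eq0 => /eqP/pronic_eq0[] ->; rewrite ?c0 ?cN1 mul0r.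
Qed.

(** Comparing coefficients at x_0 x_1 x_2 gives c(-1) = -c(0). The terms at 0 and -1 are then c(0)
    times the left-hand side; they are moved there and one divides by 1 - c(0). *)
Lemma relation_normalize q (c : int -> C) : relation a q c -> c 0 != 1 ->
  exists c', relation a q c' /\ normalized c'.
Proof.
move=> rc c01.
have cN1 : c (-1) = - c 0.
  have [r [ur r01 _ rE]] := rel_sumE q 0 (rel_lead 0 0) 0.
  have := rc 0 (rel_lead 0 0); rewrite rE.
  have t0 : rel_term a q 0 0 (rel_lead 0 0) = 1 := rel_term_lead q 0 0.
  have t1 : rel_term a q 0 (-1) (rel_lead 0 0) = 1.
    by have := rel_term_lead q 0 (-1); rewrite rel_leadN1.
  rewrite t0 t1 subrr !mulr1 big_seq big1 => [|b /r01[b0 b1]]; last first.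
    apply/eqP/negPn/negP.
    rewrite mulf_eq0 negb_or => /andP[_ /rel_term_lead_neq0[]].
      by move=> /esym/(rel_lead_inj b0 b1)/eqP; rewrite (negPf b0).
    by rewrite ltn0.
  by rewrite addr0 addrC => /esym/eqP; rewrite addr_eq0 => /eqP.
pose c' b := if (b == 0) || (b == -1) then 0 else c b / (1 - c 0).
have d0 : 1 - c 0 != 0 by rewrite subr_eq0 eq_sym.
exists c'; split; last by rewrite /normalized /c' !eqxx.
move=> i M; have [r [ur r01 _ rE]] := rel_sumE q i M 0.
have E := etrans (rc i M) (rE c); rewrite cN1 in E.
apply: etrans (esym (rE c')).
have -> : c' 0 = 0 by rewrite /c' eqxx.
have -> : c' (-1) = 0 by rewrite /c' eqxx orbT.
have solve (x y s t : C) : x - y = c 0 * x + (- c 0 * y + s) ->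
    s = (1 - c 0) * t -> x - y = 0 * x + (0 * y + t).
  move=> Exy st; apply: (mulfI d0); rewrite mul0r mul0r add0r add0r -st.
  have -> : (1 - c 0) * (x - y) = (x - y) - (c 0 * x + (- c 0 * y + s)) + s by ring.
  by rewrite -Exy subrr add0r.
apply: solve E _; rewrite mulr_sumr big_seq [RHS]big_seq; apply: eq_bigr => b.
move=> /r01[/negPf b0 /negPf b1].
have -> : c' b = c b / (1 - c 0) by rewrite /c' b0 b1.
by rewrite mulrA mulrCA mulfV // mulr1.
Qed.

End RelTerms.

(** * Gluing the truncated relations *)

Definition mshift (i : int) (M : monom) : monom := seq_mset [seq x + i | x <- (M : seq int)].

Lemma mshiftE i M x : mshift i M x = M (x - i).
Proof.
rewrite /mshift mset_seqE count_map -count_mem_mset; apply: eq_count => y /=.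
by rewrite eq_sym -subr_eq eq_sym.
Qed.

Lemma mshiftD i A B : mshift i (A `+` B) = mshift i A `+` mshift i B.
Proof. by apply/msetP => x; rewrite !(mshiftE, msetE2). Qed.

Lemma mshift1 i x : mshift i [mset x] = [mset x + i].
Proof. by apply/msetP => y; rewrite mshiftE !msetnE subr_eq. Qed.

Lemma mshiftK i : cancel (mshift i) (mshift (- i)).
Proof. by move=> M; apply/msetP => x; rewrite !mshiftE opprK addrK. Qed.

Lemma mshift_zmon i k j : mshift i (zmon k j) = zmon (k + i) j.
Proof. by rewrite /zmon mshiftD !mshift1; congr (_ `+` _); congr [mset _]; ring. Qed.

Lemma mset_size1 (M : monom) : size M = 1%N -> exists x, M = [mset x].
Proof.
case Ms : (M : seq int) => [//|x [|//]] _; exists x; apply/msetP => y.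
by rewrite -count_mem_mset Ms msetnE /= addn0 eq_sym; case: (y == x).
Qed.

Section Main.
Variables (R : realType) (a : nat -> R[i]).
Local Notation C := (R[i]).
Local Notation fseries := (fseries R).
Implicit Types (f g h : fseries) (M m : monom) (q : C).

Lemma gen_mshift q m k i M :
  gen a q (mshift i m, k + i) (mshift i M) = gen a q (m, k) M.
Proof.
have [[j ->]|nj] := pselect (exists j, M = m `+` zmon k j).
  by rewrite mshiftD mshift_zmon !gen_zmon.
transitivity (0 : C); [|symmetry]; apply/eqP/negPn/negP => /gen_supp[j /= Mj].
  apply: nj; exists j; apply: (can_inj (mshiftK i)).
  by rewrite Mj mshiftD mshift_zmon.
by apply: nj; exists j.
Qed.

Lemma rel_term_mshift q i b M : rel_term a q i b (mshift i M) = rel_term a q 0 b M.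
Proof.
rewrite /rel_term -[RHS](gen_mshift _ _ _ i) mshift1.
have -> : 0 - 2 * b + i = i - 2 * b by ring.
by have -> : 0 + 1 + b + i = i + 1 + b by ring.
Qed.

(** The coefficients do not depend on i, and translating all indices by i carries the case 0 to the
    case i. *)
Lemma relation_translate q c :
  (forall M, rel_term a q 0 0 M - rel_term a q 0 (-1) M =
     \sum_(b \in [set: int]) c b * rel_term a q 0 b M) -> relation a q c.
Proof.
move=> H i M'; pose M := mshift (- i) M'.
have -> : M' = mshift i M by rewrite /M -{1}(opprK i) mshiftK.
rewrite (rel_term_mshift q i 0) (rel_term_mshift q i (-1)).
apply: etrans (H M) _; apply: eq_fsbigr => b _.
by rewrite (rel_term_mshift q i b).
Qed.

Lemma relationP q (c : int -> C) : relation a q c <-> forall i : int,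
  smul (X i) (z a q (i + 1)) - smul (X (i + 2)) (z a q i) =
  formal_sum setT (fun b : int => c b *: smul (X (i - 2 * b)) (z a q (i + 1 + b))).
Proof.
have lhsE i := congr2 (fun f g : fseries => f - g) (rel_term0 a q i) (rel_termN1 a q i).
split=> [rc i|rc i M].
  by apply: etrans (esym (lhsE i)) _; apply/funext => M; exact: (rc i M).
exact: (congr1 (fun f : fseries => f M) (etrans (lhsE i) (rc i))).
Qed.

Lemma relation_flat (c : int -> C) : relation a 1 c -> normalized c ->
  flat_deformation (z a).
Proof.
move=> rc nc q n l; exists 0 => N _; exists (size (red_monoms N n l)).
have dq q' : dimN N (ideal_gen setT (z a q')) n l (size (red_monoms N n l)).
  apply: red_indep_dimN; apply: relation_red_indep (relation1_relation q' rc nc) _.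
  by case: nc => c0 c1; split; rewrite ?c0 ?c1 mul0r.
by split; exact: dq.
Qed.

(** At q = 0 the relation with zero coefficients holds, so the reduced monomials form a basis and d
    is their number. At q they span a space of the same dimension d, hence are independent. *)
Lemma dimN_red_indep N n l q d : dimN N (ideal_gen setT (z a 0)) n l d ->
  dimN N (ideal_gen setT (z a q)) n l d -> red_indep a N n l q.
Proof.
move=> d0 dq.
have i0 : red_indep a N n l 0.
  have nc : normalized (fun=> 0 : C) by [].
  by apply: relation_red_indep nc; exact: relation_q0.
have r0 := red_indep_dimN i0.
have Z := @ideal_cutoffZ R a N; have A := @ideal_cutoffD R a N; have O := @ideal_cutoff0 R a N.
have [dr _] := quot_dim_spanning (O 0) (A 0) (Z 0) d0 (red_basis_spans a N n l 0).
have [e [se _]] := quot_dim_spans_mod (O 0) (Z 0) d0.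
have [rd _] := quot_dim_spanning (O 0) (A 0) (Z 0) r0 se.
have [_ H] := quot_dim_spanning (O q) (A q) (Z q) dq (red_basis_spans a N n l q).
by move=> c; apply: H; apply/eqP; rewrite eqn_leq dr rd.
Qed.

Definition rel_upto (N : int) (c : int -> C) : Prop := normalized c /\
  forall M, bounded N M -> rel_term a 1 0 0 M - rel_term a 1 0 (-1) M =
    \sum_(b \in [set: int]) c b * rel_term a 1 0 b M.

(** Subtracting terms with b in [s] from the S-pair [f] kills all nonreduced coefficients. The
    remainder [h] is a reduced combination in the ideal modulo the cutoff, so it vanishes by
    independence. *)
Lemma red_indep_rel_upto N : red_indep a N 3 3 1 -> exists c, rel_upto N c.
Proof.
move=> indep; pose S := comp_monoms N 3 3.
pose s := undup [seq b <- [seq t.2 - 1 | t <- comp_gens N 3 3] |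
                 [&& b != 0, b != -1 & rel_lead 0 b \in S]].
have mem_s b : (b \in s) = [&& b != 0, b != -1 & rel_lead 0 b \in S].
  rewrite mem_undup mem_filter andb_idr // => /and3P[_ _ bS].
  apply/mapP; exists ([mset 0 - 2 * b], 0 + 1 + b); first by rewrite mem_comp_gens.
  by rewrite /=; ring.
pose u b : fseries := rel_term a 1 0 b.
pose f : fseries := u 0 - u (-1).
have [c Hc] : exists c : int -> C, forall b, b \in s ->
    f (rel_lead 0 b) = \sum_(b' <- s) c b' * u b' (rel_lead 0 b).
  apply: (@triangular_solve _ _ _ pronic (fun b' b => u b' (rel_lead 0 b))).
  - exact: undup_uniq.
  - by move=> b _; exact: rel_term_lead.
  move=> b b'; rewrite mem_s => /and3P[b0 b1 _] _ /rel_term_lead_neq0[|]; last by right.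
  by move=> e; left; apply: rel_lead_inj => //.
pose h : fseries := f - \sum_(b <- s) c b *: u b.
have hE M : h M = f M - \sum_(b <- s) c b * u b M by rewrite /h fsD fsN fs_sum.
have u_homog b : homog 3 3 (u b).
  by have := @rel_term_homog R a 1 0 b; rewrite mulr0 add0r.
have h_homog : homog 3 3 h.
  have N1 (g : fseries) : homog 3 3 g -> homog 3 3 (- g).
    by rewrite -scaleN1r; exact: homogZ.
  apply: homogD; first by apply: homogD => //; exact: N1.
  apply: N1; elim/big_ind: _ => [||b _]; [exact: homog0|exact: homogD|exact: homogZ].
have h_ideal : comp_ideal a N 3 3 1 h.
  have N1 (g : fseries) : comp_ideal a N 3 3 1 g -> comp_ideal a N 3 3 1 (- g).
    by rewrite -scaleN1r; exact: comp_idealZ.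
  apply: comp_idealD.
    by apply: comp_idealD; [|apply: N1]; exact: gen_comp_ideal.
  apply: N1; elim/big_ind: _ => [||b _].
  - exact: comp_ideal0.
  - exact: comp_idealD.
  by apply: comp_idealZ; exact: gen_comp_ideal.
have h0 M : M \in nonred_monoms N 3 3 -> h M = 0.
  rewrite mem_nonred_monoms => /andP[rM MS].
  (* In degree (3, 3) a multiple m x_k x_(k+1) has m = x_(2-2k), which is [rel_lead 0 b] for b = k -
     1. *)
  have [b Mb] : exists b, M = rel_lead 0 b.
    have := lead_sel rM; case: (sel M) => m k Mm; exists (k - 1).
    have : mdeg M = (3, 3) by move: MS; rewrite mem_comp_monoms => /andP[_ /eqP].
    rewrite -Mm /lead /= mdegD mdeg_zmon => dM.
    have [x mx] : exists x, m = [mset x].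
      apply: mset_size1; have := congr1 snd dM; rewrite /mdeg /=; lia.
    have xE : x = 0 - 2 * (k - 1).
      have := congr1 fst dM; rewrite mx mdeg1 /=; lia.
    rewrite /rel_lead /lead /= mx xE; congr (_ `+` zmon _ 0); lia.
  have [bs|] := boolP (b \in s); first by rewrite Mb hE Hc // subrr.
  rewrite mem_s -Mb MS andbT negb_and !negbK => b01.
  (* What remains is x_0 x_1 x_2: the two halves of [f] cancel there, and the terms with b in [s]
     start at larger weight. *)
  have {b01}M0 : M = rel_lead 0 0.
    by rewrite Mb; case/orP: b01 => /eqP -> //; exact: rel_leadN1.
  have f0 : f M = 0.
    rewrite /f fsD fsN M0 {1}/u rel_term_lead -rel_leadN1 /u rel_term_lead.
    exact: subrr.
  rewrite hE f0 sub0r big_seq big1 ?oppr0 // => b'; rewrite mem_s => /and3P[b0 b1 _].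
  have -> : u b' M = 0; last exact: mulr0.
  apply/eqP/negPn/negP; rewrite M0 => /rel_term_lead_neq0[]; last by rewrite ltn0.
  by move=> /esym/(rel_lead_inj b0 b1)/eqP; rewrite (negPf b0).
pose ch (k : 'I_(size (red_monoms N 3 3))) := h (nth mset0 (red_monoms N 3 3) k).
have sumE M : M \in S -> (\sum_k ch k *: red_basis R k) M = h M.
  move=> MS; have [rM|rM] := boolP (reduced M); last first.
    by rewrite red_basis_out ?h0 ?mem_nonred_monoms ?rM // mem_filter negb_and rM.
  have MSr : (index M (red_monoms N 3 3) < size (red_monoms N 3 3))%N.
    by rewrite index_mem mem_filter rM.
  have <- : nth mset0 (red_monoms N 3 3) (Ordinal MSr) = M.
    by rewrite /= nth_index // -index_mem.
  by rewrite red_basis_nth.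
have ch0 : forall k, ch k = 0.
  apply: indep; apply: (@comp_ideal_ideal _ _ N 3 3).
    exact: red_basis_sum_homog.
  by apply: eq_comp_ideal h_ideal => M MS; rewrite sumE.
exists (fun b => if b \in s then c b else 0); split.
  by split; rewrite mem_s ?eqxx ?andbF.
move=> M bM; rewrite (@fsbigE _ _ _ _ _ s) ?undup_uniq //; last first.
  by move=> b _ /negPf ->; rewrite mul0r.
under eq_bigl do rewrite in_setT.
rewrite big_seq; under eq_bigr => b -> do idtac.
rewrite -big_seq; apply/eqP; rewrite -subr_eq0; apply/eqP.
apply: etrans (esym (hE M)) _.
have [MS|MS] := boolP (M \in S).
  by rewrite -sumE // fs_sum big1 // => k _; rewrite ch0 scale0r.
apply/eqP/negPn/negP => /h_homog dM; case/negP: MS.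
by rewrite mem_comp_monoms bM dM eqxx.
Qed.

(** Induction on [pronic b]: the coefficient at [rel_lead 0 b] contains [c b] once and otherwise
    only terms of smaller [pronic], whose leads also survive the cutoff. *)
Lemma rel_upto_unique N c c' : rel_upto N c -> rel_upto N c' ->
  forall b, bounded N (rel_lead 0 b) -> c b = c' b.
Proof.
move=> [[c0 c1] Hc] [[c'0 c'1] Hc'] b.
have [k] := ubnP (pronic b); elim: k b => // k IH b; rewrite ltnS => bk bN.
have [->|b0] := eqVneq b 0; first by rewrite c0 c'0.
have [->|b1] := eqVneq b (-1); first by rewrite c1 c'1.
have [r [ur r01 br rE]] := rel_sumE a 1 0 (rel_lead 0 b) b.
have E := etrans (esym (etrans (Hc _ bN) (rE c))) (etrans (Hc' _ bN) (rE c')).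
rewrite c0 c1 c'0 c'1 in E; move/addrI/addrI: E => E.
move: E; rewrite !(bigD1_seq b (br b0 b1) ur) /= rel_term_lead.
rewrite [X in c b * 1 + X](_ : _ =
    \sum_(b' <- r | b' != b) c' b' * rel_term a 1 0 b' (rel_lead 0 b)); last first.
  rewrite big_seq_cond [RHS]big_seq_cond; apply: eq_bigr => b' /andP[b'r b'b].
  have [->|nz] := eqVneq (rel_term a 1 0 b' (rel_lead 0 b)) 0.
    exact: etrans (mulr0 _) (esym (mulr0 _)).
  have b'N := rel_term_bounded nz bN.
  rewrite IH //; case: (rel_term_lead_neq0 nz) => [|lt_b]; last exact: leq_trans lt_b bk.
  by move/(rel_lead_inj b0 b1) => bb'; rewrite bb' eqxx in b'b.
by move/addIr; rewrite mulr1 mulr1.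
Qed.

Lemma rel_upto_le (N N' : int) c : N <= N' -> rel_upto N' c -> rel_upto N c.
Proof.
move=> NN' [nc Hc]; split=> // M /boundedP bM; apply: Hc; apply/boundedP => i iM.
exact: le_trans (bM i iM) NN'.
Qed.

(** By uniqueness the coefficient at b is the same for every cutoff that keeps its lead, so it may
    be read off at one of them; each monomial is then checked at a cutoff that keeps it. *)
Lemma rel_upto_relation (N0 : int) : (forall N : int, N0 <= N -> exists c, rel_upto N c) ->
  exists c, relation a 1 c /\ normalized c.
Proof.
move=> H.
have /choice[F HF] (N : int) : exists c, N0 <= N -> rel_upto N c.
  by case: (boolP (N0 <= N)) => [/H[c Hc]|_]; [exists c|exists (fun=> 0)].
(* The indices of [rel_lead 0 b] are -2b, b + 1 and b + 2, all at most 2|b| + 2. *)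
pose B (b : int) : int := Num.max N0 (2 * `|b| + 2).
have B0 b : N0 <= B b by rewrite le_max lexx.
have BB b : bounded (B b) (rel_lead 0 b).
  have hB : 2 * `|b| + 2 <= B b by rewrite le_max lexx orbT.
  rewrite /rel_lead /lead /= zmon0 !boundedD !bounded1.
  by apply/and3P; split; apply: le_trans hB; lia.
have FE N b : N0 <= N -> bounded N (rel_lead 0 b) -> F N b = F (B b) b.
  move=> NN bN; have [NB|/ltW BN] := leP N (B b).
    exact: (rel_upto_unique (HF _ NN) (rel_upto_le NB (HF _ (B0 b))) bN).
  exact: (rel_upto_unique (rel_upto_le BN (HF _ NN)) (HF _ (B0 b)) (BB b)).
exists (fun b => F (B b) b); split.
  apply: relation_translate => M.
  have [N NN bM] : exists2 N, N0 <= N & bounded N M.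
    have [M0|[x xM]] := mset_0Vmem M.
      by exists N0 => //; apply/boundedP => i; rewrite M0 in_mset0.
    have [j _ bj] := seq_has_max xM; exists (Num.max N0 j).
      by rewrite le_max lexx.
    by apply/boundedP => i /(allP bj) ij; rewrite le_max ij orbT.
  have [_ Hc] := HF _ NN; apply: etrans (Hc M bM) _; apply: eq_fsbigr => b _.
  have [->|nz] := eqVneq (rel_term a 1 0 b M) 0.
    exact: etrans (mulr0 _) (esym (mulr0 _)).
  by rewrite (FE N) //; exact: rel_term_bounded nz bM.
by split; [case: (HF _ (B0 0)) => -[]|case: (HF _ (B0 (-1))) => -[]].
Qed.

End Main.

(** * Holomorphic coefficients and the two implications *)

Lemma holomorphic_monomial (R : realType) (c : R[i]) (n : nat) :
  holomorphic (fun q => c * q ^+ n).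
Proof.
move=> q; apply: (@derivableZ _ _ _ (fun x : R[i]^o => x ^+ n : R[i]^o) c).
exact: exprn_derivable.
Qed.

(** By continuity f stays within distance 1 of 0 near 0. This supplies a parameter at which a
    relation can be both normalized and rescaled. *)
Lemma holomorphic_neq1 (R : realType) (f : R[i] -> R[i]) :
  holomorphic f -> f 0 = 0 -> exists2 q, q != 0 & f q != 1.
Proof.
move=> hf f0.
have cf : {for (0 : R[i]^o), continuous (f : R[i]^o -> R[i]^o)}.
  exact/differentiable_continuous/derivable1_diffP/hf.
have nf : \forall q \near (0 : R[i]^o), `|(f 0 : R[i]^o) - f q| < 1.
  by move/cvgrPdist_lt : cf; exact.
have [q [q0 fq]] : exists q : R[i]^o, q != 0 /\ `|(f 0 : R[i]^o) - f q| < 1.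
  apply: (@filter_ex _ (0 : R[i]^o)^').
  near=> q; split; near: q; [exact: nbhs_dnbhs_neq|exact: nbhs_dnbhs].
exists q => //; apply: contraTneq fq => ->.
by rewrite f0 sub0r normrN normr1 ltxx.
Unshelve. all: by end_near.
Qed.

Theorem theorem4p1 (R : realType) (a : nat -> R[i]) :
  flat_deformation (z a) <->
  exists g : int -> R[i] -> R[i],
    [/\ forall b : int, holomorphic (g b),
        forall b : int, g b 0 = 0 &
        forall (q : R[i]) (i : int),
          smul (X i) (z a q (i + 1)) - smul (X (i + 2)) (z a q i) =
          formal_sum setT
            (fun b : int => g b q *: smul (X (i - 2 * b)) (z a q (i + 1 + b)))].
Proof.
split=> [flat|[g [hg g0 Hg]]].
  (* Both x_0 z_1 and x_2 z_0 have degree (3, 3). *)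
  have [N0 HN0] := flat 1 3 3.
  have [N /HN0[d [d1 d0]]|c [rc nc]] := @rel_upto_relation _ a N0.
    exact: red_indep_rel_upto (dimN_red_indep d0 d1).
  exists (fun b q => c b * q ^+ (6 * pronic b)); split=> [b|b|q i].
  - exact: holomorphic_monomial.
  - rewrite expr0n; case: eqP => [|_]; last exact: mulr0.
    case: nc => c0 c1; move/eqP; rewrite muln_eq0 => /eqP/pronic_eq0[] ->.
      by rewrite c0 mul0r.
    by rewrite c1 mul0r.
  by move: i; apply/relationP; exact: relation1_relation.
(* The relation at this single q is enough: it is normalized, carried to parameter 1 by dividing out
   the powers of q, and from there it reaches every parameter. *)
have [q q0 gq] := holomorphic_neq1 (hg 0) (g0 0).
have rq : relation a q (g^~ q) by apply/relationP; exact: Hg.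
have [c [rc [c0 c1]]] := relation_normalize rq gq.
pose c' b := c b / q ^+ (6 * pronic b).
have nc' : normalized c' by rewrite /normalized /c' c0 c1 !mul0r.
have c'E : (fun b => c' b * q ^+ (6 * pronic b)) = c.
  by apply/funext => b; rewrite /c' divfK // expf_neq0.
have r1 := (relation_scale a c' q0).1; rewrite c'E in r1.
exact: relation_flat (r1 rc) nc'.
Qed.
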